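(* Let $m\ge 1$, $1\le p<\infty$, and let $U\subset F_B(\mathbb{R}^m)^p$. Then $U$ is a totally bounded set in $(F_B(\mathbb{R}^m)^p, d_p)$ if and only if (i) $U$ is uniformly $p$-mean bounded; and (ii) $U$ is $p$-mean equi-left-continuous.
   Context: $H$ is the Hausdorff metric on nonempty closed subsets of $\mathbb{R}^m$ (Euclidean distance): $H(A,B)=\max\{\sup_{a\in A}\inf_{b\in B}d(a,b),\ \sup_{b\in B}\inf_{a\in A}d(a,b)\}$ (possibly $+\infty$). A fuzzy set on $\mathbb{R}^m$ is a function $u:\mathbb{R}^m\to[0,1]$; its cuts are $[u]_\alpha=\{x: u(x)\ge\alpha\}$ for $\alpha\in(0,1]$ and $[u]_0=\overline{\{x: u(x)>0\}}$. $F_B(\mathbb{R}^m)^p$ is the set of fuzzy sets $u$ on $\mathbb{R}^m$ that are normal ($u(x_0)=1$ for some $x_0$), upper semi-continuous, and satisfy $\left(\int_0^1 H([u]_\alpha,\{0\})^p\,d\alpha\right)^{1/p}<+\infty$, where $0$ is the origin. The metric is $d_p(u,v)=\left(\int_0^1 H([u]_\alpha,[v]_\alpha)^p\,d\alpha\right)^{1/p}$. A set $U\subset F_B(\mathbb{R}^m)^p$ is uniformly $p$-mean bounded if there is $M>0$ with $d_p(u,\widehat{0})\le M$ for all $u\in U$, where $\widehat 0$ is the characteristic function of $\{0\}$. $U$ is $p$-mean equi-left-continuous if for every $\varepsilon>0$ there is $\delta>0$ such that for all $0\le h<\delta$ and all $u\in U$, $\left(\int_h^1 H([u]_\alpha,[u]_{\alpha-h})^p\,d\alpha\right)^{1/p}<\varepsilon$.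 *)

(* Defs.v *)
From HB Require Import structures.
From mathcomp Require Import all_boot all_order all_algebra.
From mathcomp Require Import all_classical all_reals all_analysis.

Set Implicit Arguments.
Unset Strict Implicit.
Unset Printing Implicit Defensive.

Import Order.TTheory GRing.Theory Num.Theory.
Import numFieldNormedType.Exports.

Local Open Scope classical_set_scope.
Local Open Scope ring_scope.

(* The library's distance on ['rV[R]_m] comes from the sup norm, hence this
   separate definition; the two distances induce the same topology, so the
   library's [closure] and [nbhs] are the Euclidean ones. *)
Definition eucl_dist (R : realType) (m : nat) (x y : 'rV[R]_m) : R :=
  Num.sqrt (\sum_(i < m) (x 0 i - y 0 i) ^+ 2).

Definition hausdorff_dist (R : realType) (m : nat) (A B : set 'rV[R]_m)
    : \bar R :=
  maxe
    (ereal_sup [set ereal_inf [set (eucl_dist a b)%:E | b in B] | a in A])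
    (ereal_sup [set ereal_inf [set (eucl_dist a b)%:E | a in A] | b in B]).

Definition upper_semicontinuous (R : realType) (T : topologicalType)
    (f : T -> R) : Prop :=
  forall x a, f x < a -> \forall y \near x, f y < a.

Definition alpha_cut (R : realType) (m : nat) (u : 'rV[R]_m -> R) (alpha : R)
    : set 'rV[R]_m :=
  if alpha == 0 then closure [set x | 0 < u x] else [set x | alpha <= u x].

(* Extended-real valued.  For [u], [v] in [FB p] the integrands below are
   measurable functions of [alpha]. *)
Definition dp (R : realType) (m : nat) (p : R) (u v : 'rV[R]_m -> R) : \bar R :=
  ((\int[lebesgue_measure]_(alpha in `[0%R, 1%R])
      (hausdorff_dist (alpha_cut u alpha) (alpha_cut v alpha) `^ p)) `^ p^-1)%E.

Definition FB (R : realType) (m : nat) (p : R) : set ('rV[R]_m -> R) :=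
  [set u | [/\ forall x, 0 <= u x <= 1,
               exists x0, u x0 = 1,
               upper_semicontinuous u &
               ((\int[lebesgue_measure]_(alpha in `[0%R, 1%R])
                   (hausdorff_dist (alpha_cut u alpha) [set 0%R] `^ p)) `^ p^-1
                < +oo)%E]].

(* Total boundedness of [U] as a subset of the metric space [(X, d)]; the
   centres of the balls range over [X]. *)
Definition totally_bounded (R : realType) (T : Type) (X : set T)
    (d : T -> T -> \bar R) (U : set T) : Prop :=
  forall eps : R, 0 < eps ->
    exists F : set T, [/\ finite_set F, F `<=` X &
      U `<=` \bigcup_(c in F) [set u | (d c u < eps%:E)%E]].

Definition uniformly_p_mean_bounded (R : realType) (m : nat) (p : R)
    (U : set ('rV[R]_m -> R)) : Prop :=
  exists2 M : R, 0 < M & forall u, U u -> (dp p u (\1_[set 0%R]) <= M%:E)%E.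

(* For [h > 1] the domain [`[h, 1]] is empty and the integral is 0. *)
Definition p_mean_equi_left_continuous (R : realType) (m : nat) (p : R)
    (U : set ('rV[R]_m -> R)) : Prop :=
  forall eps : R, 0 < eps ->
    exists2 delta : R, 0 < delta &
      forall (h : R) (u : 'rV[R]_m -> R), 0 <= h < delta -> U u ->
        ((\int[lebesgue_measure]_(alpha in `[h, 1%R])
            (hausdorff_dist (alpha_cut u alpha) (alpha_cut u (alpha - h)%R) `^ p)) `^ p^-1
         < eps%:E)%E.

(* Main.v *)
(** Passing to p-th powers, [(a + b + c)^p <= 3^p (a^p + b^p + c^p)] serves as the
triangle inequality, so total boundedness, boundedness and equi-left-continuity
can all be compared through integrals of [H^p] over the levels in [(0, 1]].

For a single [u] in [FB p] the cuts of positive level are compact and depend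
left-continuously on the level. This makes the integrands measurable and, by
dominated convergence away from the level 0 and absolute continuity of the
integral near it, makes [u] alone equi-left-continuous. A finite net transfers
this property, and the bound, from its centres to all of [U].

Conversely, equi-left-continuity compares low levels with levels [s] higher, so
the radii of the cuts have uniformly small integral over [(0, h]] for small [h].
The cuts of level at least [h] lie in a common ball, where a finite net [G] is
chosen. With [h = 1/N], [u] is close to the step function whose cut over
[(k h, (k+1) h]] consists of the points of [G] near the cut of [u] of level
[k h]; only finitely many functions on [G] have values in [{0, 1/N, ..., 1}]. *)
Require Import Defs.
From HB Require Import structures.
From mathcomp Require Import all_boot all_order all_algebra.
From mathcomp Require Import all_classical all_reals all_analysis.
From mathcomp Require Import measurable_realfun.
From mathcomp Require Import ring lra zify.

Set Implicit Arguments.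
Unset Strict Implicit.
Unset Printing Implicit Defensive.

Import Order.TTheory GRing.Theory Num.Theory.
Import numFieldNormedType.Exports.

Local Open Scope classical_set_scope.
Local Open Scope ring_scope.

(** * The Hausdorff distance *)

Section Euclidean.
Context (R : realType) (m : nat).
Implicit Types x y z : 'rV[R]_m.

(** The sum of the squares of [T * a i - P * b i] is nonnegative and equals [T * (T * S - P ^+ 2)].
    If [T] vanishes, so does every [b i], and hence [P]. *)
Lemma sum_cauchy_schwarz (I : finType) (a b : I -> R) :
  (\sum_i a i * b i) ^+ 2 <= (\sum_i a i ^+ 2) * (\sum_i b i ^+ 2).
Proof.
set S := \sum_i a i ^+ 2; set T := \sum_i b i ^+ 2; set P := \sum_i a i * b i.
have T0 : 0 <= T by apply: sumr_ge0 => i _; exact: sqr_ge0.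
have S0 : 0 <= S by apply: sumr_ge0 => i _; exact: sqr_ge0.
have E : \sum_i (T * a i - P * b i) ^+ 2 = T * (T * S - P ^+ 2).
  rewrite (eq_bigr (fun i => T ^+ 2 * a i ^+ 2 - (2 * T * P) * (a i * b i) +
      P ^+ 2 * b i ^+ 2)); last by move=> i _; ring.
  by rewrite big_split sumrB /= -!mulr_sumr -/S -/T -/P; ring.
have : 0 <= T * (T * S - P ^+ 2).
  by rewrite -E; apply: sumr_ge0 => i _; exact: sqr_ge0.
have [Tp|] := ltP 0 T; first by rewrite pmulr_rge0// subr_ge0 mulrC.
move=> Tn _; have T00 : T = 0 by apply/eqP; rewrite eq_le Tn.
suff -> : P = 0 by rewrite expr0n mulr_ge0.
rewrite /P big1 // => i _.
have /psumr_eq0P : T = 0 by [].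
move=> /(_ (fun i _ => sqr_ge0 _)) /(_ i isT) /eqP.
by rewrite sqrf_eq0 => /eqP ->; rewrite mulr0.
Qed.

Lemma eucl_dist_ge0 x y : 0 <= eucl_dist x y.
Proof. exact: sqrtr_ge0. Qed.

Lemma eucl_distC x y : eucl_dist x y = eucl_dist y x.
Proof. by congr Num.sqrt; apply: eq_bigr => i _; rewrite -sqrrN opprB. Qed.

Lemma eucl_distxx x : eucl_dist x x = 0.
Proof.
by rewrite /eucl_dist big1 ?sqrtr0// => i _; rewrite subrr expr0n.
Qed.

Lemma eucl_dist_triangle y x z :
  eucl_dist x z <= eucl_dist x y + eucl_dist y z.
Proof.
set a := fun i => x 0 i - y 0 i; set b := fun i => y 0 i - z 0 i.
have sq0 (f : 'I_m -> R) : 0 <= \sum_i f i ^+ 2.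
  by apply: sumr_ge0 => i _; exact: sqr_ge0.
rewrite -(@ler_pXn2r _ 2)// ?nnegrE ?addr_ge0 ?eucl_dist_ge0//.
rewrite sqrrD !sqr_sqrtr; [|exact: sq0..].
have -> : \sum_i (x 0 i - z 0 i) ^+ 2 =
    \sum_i a i ^+ 2 + (\sum_i a i * b i) *+ 2 + \sum_i b i ^+ 2.
  rewrite -sumrMnl -!big_split /=; apply: eq_bigr => i _.
  by rewrite /a /b; ring.
rewrite lerD2r lerD2l lerMn2r/= -sqrtrM; last exact: sq0.
by rewrite (le_trans (ler_norm _))// -sqrtr_sqr ler_wsqrtr// sum_cauchy_schwarz.
Qed.

Lemma coord_le_eucl_dist x y i : `|x 0 i - y 0 i| <= eucl_dist x y.
Proof.
rewrite -sqrtr_sqr ler_wsqrtr// (bigD1 i)//= lerDl.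
by apply: sumr_ge0 => j _; exact: sqr_ge0.
Qed.

Lemma norm_le_eucl_dist x y : `|x - y| <= eucl_dist x y.
Proof.
have := eucl_dist_ge0 x y; rewrite [in X in _ -> X]/Num.norm /= mx_normrE => d0.
apply: bigmax_le => // -[i j] _; rewrite ord1 !mxE; exact: coord_le_eucl_dist.
Qed.

Lemma coord_le_norm x i : `|x 0 i| <= `|x|.
Proof.
rewrite [leRHS]/Num.norm /= mx_normrE.
exact: (@le_bigmax _ _ _ 0 (fun k : 'I_1 * 'I_m => `|x k.1 k.2|) (0, i)).
Qed.

Lemma eucl_dist_lt_coord x y (e : R) : 0 < e ->
  (forall i, `|x 0 i - y 0 i| <= e / m.+1%:R) -> eucl_dist x y < e.
Proof.
move=> e0 xye; have m0 : (0 : R) < m.+1%:R by rewrite ltr0n.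
(* There are [m] squares, each at most [(e / m.+1) ^+ 2], and [m < m.+1 ^ 2]; this also covers
   [m = 0]. *)
apply: (@le_lt_trans _ _ (Num.sqrt (m%:R * (e / m.+1%:R) ^+ 2))).
  rewrite ler_wsqrtr// mulr_natl -[X in _ *+ X]card_ord -sumr_const ler_sum//.
  move=> i _; rewrite -real_normK ?num_real// ler_pXn2r ?nnegrE//.
  by rewrite (le_trans _ (xye i)).
rewrite -[ltRHS]ger0_norm ?ltW// -sqrtr_sqr ltr_sqrt ?exprn_gt0//.
rewrite exprMn mulrCA gtr_pMr ?exprn_gt0// exprVn ltr_pdivrMr ?exprn_gt0//.
by rewrite mul1r -natrX ltr_nat; nia.
Qed.

End Euclidean.

(** Lets Hausdorff distances be compared through real radii strictly above them, the only ones at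
    which near points are known to exist: the infima need not be attained. *)
Lemma lee_of_fin_ubounds (R : realType) (x y : \bar R) :
  (forall r : R, (x < r%:E)%E -> (y <= r%:E)%E) -> (y <= x)%E.
Proof.
case: x => [x| |] h; last 2 first.
- exact: leey.
- have hr r : (y <= r%:E)%E by apply: h; exact: ltNyr.
  case: y hr {h} => [y| |] // hr; last by have := hr 0%R.
  by have := hr (y - 1)%R; rewrite lee_fin leNgt ltrBlDr ltrDl ltr01.
apply/lee_addgt0Pr => e e0; rewrite -EFinD; apply: h.
by rewrite lte_fin ltrDl.
Qed.

Section Hausdorff.
Context (R : realType) (m : nat).
Implicit Types A B C : set 'rV[R]_m.
Local Notation H := (@hausdorff_dist R m).

Lemma hausdorff_distC A B : H A B = H B A.
Proof.
rewrite /hausdorff_dist maxC; congr maxe; congr ereal_sup;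
  by apply: eq_imagel => x _; congr ereal_inf; apply: eq_imagel => y _;
     rewrite eucl_distC.
Qed.

Lemma hausdorff_dist_le A B (r : R) :
  (forall a, A a -> exists2 b, B b & eucl_dist a b <= r) ->
  (forall b, B b -> exists2 a, A a & eucl_dist a b <= r) ->
  (H A B <= r%:E)%E.
Proof.
move=> AB BA; rewrite /hausdorff_dist ge_max; apply/andP; split.
- apply: ge_ereal_sup => _ [a Aa <-]; have [b Bb ab] := AB _ Aa.
  apply: (@le_trans _ _ (eucl_dist a b)%:E); last by rewrite lee_fin.
  by apply: ereal_inf_lbound; exists b.
- apply: ge_ereal_sup => _ [b Bb <-]; have [a Aa ab] := BA _ Bb.
  apply: (@le_trans _ _ (eucl_dist a b)%:E); last by rewrite lee_fin.
  by apply: ereal_inf_lbound; exists a.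
Qed.

Lemma hausdorff_dist_lt A B (r : R) (a : 'rV[R]_m) : (H A B < r%:E)%E -> A a ->
  exists2 b, B b & eucl_dist a b < r.
Proof.
rewrite /hausdorff_dist gt_max => /andP[Hr _] Aa.
have /ereal_inf_ltP[_ [b Bb <-]] :
    (ereal_inf [set (eucl_dist a b)%:E | b in B] < r%:E)%E.
  by apply: le_lt_trans Hr; apply: ereal_sup_ubound; exists a.
by rewrite lte_fin => ab; exists b.
Qed.

(** For two empty sets both suprema are [-oo]; a point of [A] makes the first one at least an
    infimum of distances. *)
Lemma hausdorff_dist_ge0 A B : A !=set0 -> (0 <= H A B)%E.
Proof.
move=> [a Aa]; rewrite /hausdorff_dist le_max; apply/orP; left.
apply: (@le_trans _ _ (ereal_inf [set (eucl_dist a b)%:E | b in B])).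
  by apply: le_ereal_inf_tmp => _ [b _ <-]; rewrite lee_fin eucl_dist_ge0.
by apply: ereal_sup_ubound; exists a.
Qed.

Lemma hausdorff_dist_triangle B A C : A !=set0 -> B !=set0 ->
  (H A C <= H A B + H B C)%E.
Proof.
move=> A0 B0; have := hausdorff_dist_ge0 B A0.
have := hausdorff_dist_ge0 C B0.
case EAB: (H A B) => [s| |]; case EBC: (H B C) => [t| |] //= _ _;
  do ?by rewrite leey.
apply: lee_of_fin_ubounds => r; rewrite -EFinD lte_fin => str.
(* Half of the excess of [r] goes to each of the two steps through [B], so that both radii are
   strictly above the distances. *)
pose e := (r - (s + t)) / 2; have e0 : 0 < e by rewrite /e; lra.
have hAB : (H A B < (s + e)%:E)%E by rewrite EAB lte_fin ltrDl.
have hBC : (H B C < (t + e)%:E)%E by rewrite EBC lte_fin ltrDl.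
have re : r = (s + e) + (t + e) by rewrite /e; lra.
apply: hausdorff_dist_le => [a Aa|c Cc].
- have [b Bb ab] := hausdorff_dist_lt hAB Aa.
  have [c Cc bc] := hausdorff_dist_lt hBC Bb.
  by exists c => //; rewrite (le_trans (eucl_dist_triangle b _ _))// re lerD ?ltW.
- rewrite hausdorff_distC in hAB; rewrite hausdorff_distC in hBC.
  have [b Bb cb] := hausdorff_dist_lt hBC Cc.
  have [a Aa ba] := hausdorff_dist_lt hAB Bb.
  exists a => //; rewrite (le_trans (eucl_dist_triangle b _ _))// re lerD//.
    by rewrite eucl_distC ltW.
  by rewrite eucl_distC ltW.
Qed.

Lemma hausdorff_distxx A : A !=set0 -> H A A = 0%E.
Proof.
move=> A0; apply/eqP; rewrite eq_le hausdorff_dist_ge0// andbT.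
by apply: hausdorff_dist_le => a Aa; exists a; rewrite ?eucl_distxx.
Qed.

(** Only the excess of [C] over [B] counts, as [B] lies in [C]: a point of [C] is in [D], hence
    close to a point of [A], which is in [B]. For cuts this says that spreading two levels apart
    increases the distance. *)
Lemma hausdorff_dist_subl A B C D : A `<=` B -> B `<=` C -> C `<=` D ->
  (H B C <= H A D)%E.
Proof.
move=> AB BC CD; apply: lee_of_fin_ubounds => r.
rewrite hausdorff_distC => hr; have near_A := hausdorff_dist_lt hr.
apply: hausdorff_dist_le => [b /BC Cb|c /CD/near_A[a Aa ca]].
  (* The radius [r] is nonnegative since some point of [A] is at distance less than [r] from [b]. *)
  exists b => //; have [a _ /ltW] := near_A _ (CD _ Cb).
  by rewrite eucl_distxx; exact: le_trans (eucl_dist_ge0 _ _).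
by exists a; [exact: AB|rewrite eucl_distC ltW].
Qed.

Lemma hausdorff_dist0_sub A C x : A !=set0 -> A `<=` C ->
  (H A [set x] <= H C [set x])%E.
Proof.
move=> [a Aa] AC; apply: lee_of_fin_ubounds => r hr.
have h b : A b -> eucl_dist b x <= r.
  by move=> /AC/(hausdorff_dist_lt hr)[_ -> /ltW].
apply: hausdorff_dist_le => [b Ab|_ ->]; first by exists x => //; exact: h.
by exists a => //; exact: h.
Qed.

End Hausdorff.

(** * Integrals of p-th powers *)

Section Integration.
Context (R : realType).
Local Notation mu := (@lebesgue_measure R).
Implicit Types (a b h : R) (f g : R -> \bar R).

(* Every point of a superlevel set is the right end of an interval contained in
   that set, so the set is a union of intervals indexed by their rational left
   ends. *)
Lemma left_lsc_measurable a b f :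
  (forall x c : R, a < x <= b -> (c%:E < f x)%E ->
    exists2 y0, y0 < x &
      forall y, a < y -> y0 < y <= x -> (c%:E < f y)%E) ->
  measurable_fun `]a, b] f.
Proof.
move=> lsc; apply: (measurability _ (ErealGenOInfty.measurableE R)).
move=> _ [_ [c ->]] <-.
pose S := `]a, b]%classic `&` f @^-1` `]c%:E, +oo[%classic.
pose I (q : rat) := [set x : R | ratr q <= x /\
  forall y, ratr q <= y <= x -> S y].
rewrite (_ : _ `&` _ = \bigcup_q I q); last first.
  apply/seteqP; split => [x|x [q _ [qx]]]; last by apply; rewrite qx lexx.
  move=> [/=]; rewrite !in_itv/= andbT => axb cfx.
  have /andP[ax xb] := axb.
  have [y0 y0x hy] := lsc x c axb cfx.
  have maxx : Num.max a y0 < x by rewrite gt_max ax.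
  have [q] := rat_in_itvoo maxx.
  rewrite in_itv/= gt_max => /andP[/andP[aq y0q] qx].
  exists q => //; split; first exact: ltW.
  move=> y /andP[qy yx]; split=> /=; rewrite in_itv/= ?andbT.
    by rewrite (lt_le_trans aq qy) (le_trans yx xb).
  by apply: hy; rewrite ?(lt_le_trans aq qy) ?(lt_le_trans y0q qy).
apply: bigcupT_measurable_rat => q; apply: is_interval_measurable.
move=> x z [qx _] [_ hz] w /andP[xw wz]; split; first exact: le_trans xw.
by move=> y /andP[qy yw]; apply: hz; rewrite qy (le_trans yw wz).
Qed.

Lemma nonincreasing_emeasurable a b f :
  (forall x y, a < x -> x <= y -> y <= b -> (f y <= f x)%E) ->
  measurable_fun `]a, b] f.
Proof.
move=> fni; apply: left_lsc_measurable => x c /andP[ax xb] cfx.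
exists a => // y ay /andP[_ yx].
by apply: (lt_le_trans cfx); exact: fni.
Qed.

(** Change of variables: the image of Lebesgue measure under [phi] agrees with it on half-open
    intervals, hence everywhere. *)
Lemma ge0_integral_shift h a b f : measurable_fun `]a, b] f ->
  (forall x, a < x <= b -> (0 <= f x)%E) ->
  (\int[mu]_(x in `](a + h)%R, (b + h)%R]) f (x - h)%R = \int[mu]_(x in `]a, b]) f x)%E.
Proof.
move=> mf f0.
pose phi : measurableTypeR R -> measurableTypeR R := fun x => x - h.
have mphi : measurable_fun setT phi by exact: measurable_funB.
apply/esym; rewrite (@eq_measure_integral _ _ _ _ (pushforward mu phi) mu); last first.
  move=> A mA _; apply: lebesgue_measure_unique => // _ [[c d] _ <-] /=.
  rewrite /pushforward (_ : phi @^-1` _ = `]c + h, d + h]%classic); last first.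
    apply/seteqP; split => x /=; rewrite /phi !in_itv/=; lra.
  rewrite !lebesgue_measure_itv/= !lte_fin ltrD2r.
  by case: ifPn => // _; rewrite -!EFinB; congr EFin; ring.
rewrite ge0_integral_pushforward//; last first.
  by move=> x; rewrite inE/= in_itv/=; exact: f0.
congr integral; apply/seteqP; split => x /=; rewrite /phi !in_itv/=; lra.
Qed.

Context (p : R) (hp : 1 <= p).
Let p0 : 0 < p. Proof. exact: lt_le_trans hp. Qed.

Lemma poweR_le (x y : \bar R) : (0 <= x)%E -> (x <= y)%E -> (x `^ p <= y `^ p)%E.
Proof.
move=> x0 xy; apply: gt0_ler_poweR => //; first exact: ltW.
  by rewrite in_itv/= x0 leey.
by rewrite in_itv/= leey (le_trans x0 xy).
Qed.

Lemma poweR_add3_le (x y z : \bar R) : (0 <= x)%E -> (0 <= y)%E -> (0 <= z)%E ->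
  ((x + y + z) `^ p <= (3 `^ p)%:E * (x `^ p + y `^ p + z `^ p))%E.
Proof.
move=> x0 y0 z0; pose w := maxe x (maxe y z).
have w0 : (0 <= w)%E by rewrite le_max x0.
have xw : (x <= w)%E by rewrite le_max lexx.
have yw : (y <= w)%E by rewrite !le_max lexx orbT.
have zw : (z <= w)%E by rewrite !le_max lexx !orbT.
apply: (@le_trans _ _ ((3%:E * w) `^ p)%E).
  apply: poweR_le; first by rewrite !adde_ge0.
  have -> : (3%:E * w = w + w + w)%E by rewrite mule_natl -addeA.
  by rewrite !leeD.
rewrite poweRM// poweR_EFin lee_wpmul2l ?lee_fin ?powR_ge0//.
have [-> | ->] : w = x \/ w = maxe y z by rewrite /w; case: leP; auto.
  by rewrite -addeA leeDl// adde_ge0// poweR_ge0.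
have [-> | ->] : maxe y z = y \/ maxe y z = z by case: leP; auto.
  by rewrite addeAC leeDr// adde_ge0// poweR_ge0.
by rewrite leeDr// adde_ge0// poweR_ge0.
Qed.

Lemma measurable_fun_poweR (D : set R) f : measurable D -> measurable_fun D f ->
  measurable_fun D (fun x => f x `^ p)%E.
Proof.
by move=> mD mf; exact: (measurableT_comp (measurable_poweR p) mf).
Qed.

(** Removes the outer root in the power means; for infinite [x] both sides are false. *)
Lemma poweR_inv_le (x : \bar R) (r : R) : (0 <= x)%E -> 0 <= r ->
  (x `^ p^-1 <= r%:E)%E = (x <= (r `^ p)%:E)%E.
Proof.
move=> x0 r0; have pV : 0 <= p^-1 by rewrite invr_ge0 ltW.
case: x x0 => [s| |] //; last first.
  by rewrite poweRyr ?gt_eqF ?invr_gt0// !leye_eq.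
rewrite lee_fin => s0; rewrite poweR_EFin !lee_fin; apply/idP/idP => h.
  rewrite -[s]powRr1// -(mulVf (lt0r_neq0 p0)) powRrM.
  by rewrite ge0_ler_powR ?nnegrE ?powR_ge0// ltW.
rewrite -[r]powRr1// -(divff (lt0r_neq0 p0)) powRrM.
by rewrite ge0_ler_powR ?nnegrE ?powR_ge0.
Qed.

Lemma poweR_inv_lt (x : \bar R) (r : R) : (0 <= x)%E -> 0 <= r ->
  (x `^ p^-1 < r%:E)%E = (x < (r `^ p)%:E)%E.
Proof.
move=> x0 r0; have pV : 0 < p^-1 by rewrite invr_gt0.
case: x x0 => [s| |] //; last by rewrite poweRyr ?gt_eqF// !ltNge !leey.
rewrite lee_fin => s0; rewrite poweR_EFin !lte_fin; apply/idP/idP => h.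
  rewrite -[s]powRr1// -(mulVf (lt0r_neq0 p0)) powRrM.
  by rewrite gt0_ltr_powR ?nnegrE ?powR_ge0.
rewrite -[r]powRr1// -(divff (lt0r_neq0 p0)) powRrM.
by rewrite gt0_ltr_powR ?nnegrE ?powR_ge0.
Qed.

Lemma integral_poweR_ge0 (D : set R) f :
  (0 <= \int[mu]_(x in D) (f x `^ p))%E.
Proof. by apply: integral_ge0 => x _; exact: poweR_ge0. Qed.

Lemma integral_poweR_le (D : set R) f g : measurable D ->
  measurable_fun D f -> measurable_fun D g ->
  (forall x, D x -> 0 <= f x)%E -> (forall x, D x -> f x <= g x)%E ->
  (\int[mu]_(x in D) (f x `^ p) <= \int[mu]_(x in D) (g x `^ p))%E.
Proof.
move=> mD mf mg f0 fg; apply: ge0_le_integral => //.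
- by move=> x _; exact: poweR_ge0.
- exact: measurable_fun_poweR.
- exact: measurable_fun_poweR.
- by move=> x Dx; apply: poweR_le; [exact: f0|exact: fg].
Qed.

Lemma integral_poweR_le3 (D : set R) f g1 g2 g3 : measurable D ->
  measurable_fun D f -> measurable_fun D g1 ->
  measurable_fun D g2 -> measurable_fun D g3 ->
  (forall x, D x -> 0 <= f x)%E -> (forall x, D x -> 0 <= g1 x)%E ->
  (forall x, D x -> 0 <= g2 x)%E -> (forall x, D x -> 0 <= g3 x)%E ->
  (forall x, D x -> f x <= g1 x + g2 x + g3 x)%E ->
  forall r1 r2 r3 : R, (\int[mu]_(x in D) (g1 x `^ p) <= r1%:E)%E ->
  (\int[mu]_(x in D) (g2 x `^ p) <= r2%:E)%E ->
  (\int[mu]_(x in D) (g3 x `^ p) <= r3%:E)%E ->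
  (\int[mu]_(x in D) (f x `^ p) <= (3 `^ p * (r1 + r2 + r3))%:E)%E.
Proof.
move=> mD mf mg1 mg2 mg3 f0 g10 g20 g30 fg r1 r2 r3 g1r g2r g3r.
apply: (@le_trans _ _ ((3 `^ p)%:E * (\int[mu]_(x in D) (g1 x `^ p) +
     \int[mu]_(x in D) (g2 x `^ p) + \int[mu]_(x in D) (g3 x `^ p))))%E; last first.
  by rewrite EFinM !EFinD lee_wpmul2l ?lee_fin ?powR_ge0// !leeD.
have mP g : measurable_fun D g -> measurable_fun D (fun x => g x `^ p)%E.
  exact: measurable_fun_poweR.
rewrite -ge0_integralD//; try by move=> x _; exact: poweR_ge0.
2,3: exact: mP.
rewrite -ge0_integralD//.
2,4: by move=> x _; rewrite ?adde_ge0// poweR_ge0.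
2: by apply: emeasurable_funD; exact: mP.
2: exact: mP.
rewrite -ge0_integralZl_EFin//.
2: by move=> x _; rewrite !adde_ge0// poweR_ge0.
2: by apply: emeasurable_funD; [apply: emeasurable_funD|]; exact: mP.
apply: ge0_le_integral => //.
- by move=> x _; exact: poweR_ge0.
- exact: mP.
- apply: measurable_funeM.
  by apply: emeasurable_funD; [apply: emeasurable_funD|]; exact: mP.
- move=> x Dx; apply: le_trans (poweR_add3_le (g10 _ Dx) (g20 _ Dx) (g30 _ Dx)).
  by apply: poweR_le; [exact: f0|exact: fg].
Qed.

Lemma integral_poweR_le2 (D : set R) f g1 g2 (r1 r2 : R) : measurable D ->
  measurable_fun D f -> measurable_fun D g1 -> measurable_fun D g2 ->
  (forall x, D x -> 0 <= f x)%E -> (forall x, D x -> 0 <= g1 x)%E ->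
  (forall x, D x -> 0 <= g2 x)%E ->
  (forall x, D x -> f x <= g1 x + g2 x)%E ->
  (\int[mu]_(x in D) (g1 x `^ p) <= r1%:E)%E ->
  (\int[mu]_(x in D) (g2 x `^ p) <= r2%:E)%E ->
  (\int[mu]_(x in D) (f x `^ p) <= (3 `^ p * (r1 + r2))%:E)%E.
Proof.
move=> mD mf mg1 mg2 f0 g10 g20 fg g1r g2r; rewrite -[r1 + r2]addr0.
apply: (@integral_poweR_le3 D f g1 g2 (fun=> 0%E)) => //.
- by move=> x Dx; rewrite adde0; exact: fg.
- by rewrite integral0_eq// => x _; rewrite poweR0r// lt0r_neq0.
Qed.

Lemma ge0_integral_itv_split a b c f : a <= b -> b <= c ->
  measurable_fun `]a, c] f -> (forall x, a < x <= c -> (0 <= f x)%E) ->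
  (\int[mu]_(x in `]a, c]) f x =
   \int[mu]_(x in `]a, b]) f x + \int[mu]_(x in `]b, c]) f x)%E.
Proof.
move=> ab bc mf f0.
have acE : `]a, c]%classic = `]a, b]%classic `|` `]b, c]%classic.
  by rewrite (@itv_bndbnd_setU _ _ (BRight a) (BRight b) (BRight c)).
rewrite acE ge0_integral_setU//.
- by rewrite -acE.
- by move=> x; rewrite -acE/= in_itv/=; exact: f0.
- apply/disj_setPS => x [/=]; rewrite !in_itv/= => /andP[_ xb] /andP[bx _].
  by move: (lt_le_trans bx xb); rewrite ltxx.
Qed.

(** Dominated convergence with limit 0: for nonnegative terms, being eventually below every positive
    real is pointwise convergence to 0. *)
Lemma dominated_integral_small (D : set R) (f_ : nat -> R -> \bar R) g (e : R) :
  measurable D -> (forall n, measurable_fun D (f_ n)) -> measurable_fun D g ->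
  (forall n x, D x -> (0 <= f_ n x)%E /\ (f_ n x <= g x)%E) ->
  (forall x, D x -> forall d : R, 0 < d ->
    \forall n \near \oo, (f_ n x <= d%:E)%E) ->
  (\int[mu]_(x in D) g x < +oo)%E -> 0 < e ->
  exists n, (\int[mu]_(x in D) f_ n x <= e%:E)%E.
Proof.
move=> mD mf mg fg f0 goo e0.
have g0 x : D x -> (0 <= g x)%E.
  by move=> Dx; have [] := fg 0%N x Dx; exact: le_trans.
have ig : mu.-integrable D g.
  apply/integrableP; split=> //; apply: le_lt_trans goo.
  apply: ge0_le_integral => //; first exact: measurableT_comp.
  by move=> x Dx; rewrite gee0_abs// g0.
have cvg0 : {ae mu, forall x, D x -> f_ ^~ x @ \oo --> (0%E : \bar R)}.
  (* Convergence in the extended reals asks first for eventual finiteness, which the bound 1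
     provides. *)
  apply: aeW => x Dx; apply/fine_cvgP; split.
    have := f0 x Dx 1 ltr01; apply: filterS => n fn1.
    have [fn0 _] := fg n x Dx.
    by rewrite ge0_fin_numE// (le_lt_trans fn1)// ltry.
  apply/cvgrPdist_le => d d0; have := f0 x Dx d d0; apply: filterS => n fnd.
  have [fn0 _] := fg n x Dx; rewrite sub0r normrN ger0_norm ?fine_ge0//.
  by rewrite -lee_fin fineK// ge0_fin_numE// (le_lt_trans fnd)// ltry.
have dom : {ae mu, forall x n, D x -> (`|f_ n x| <= g x)%E}.
  by apply: aeW => x n Dx; have [fn0 fng] := fg n x Dx; rewrite gee0_abs.
have [_ _] := @dominated_convergence _ _ _ mu D mD f_ (fun=> 0%E) g mf
  (measurable_cst _) cvg0 ig dom.
rewrite integral0 => /(_ [set y | (y < e%:E)%E]) /=.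
have nb : nbhs (0%E : \bar R) [set y | (y < e%:E)%E].
  by apply: open_nbhs_nbhs; split; [exact: open_ereal_lt_ereal|rewrite /= lte_fin].
by move=> /(_ nb) [n _ /(_ n (leqnn n))] /= /ltW ?; exists n.
Qed.

(* Absolute continuity of the integral at the left end of the interval. *)
Lemma ge0_integral_itv_small a b f (e : R) : a < b ->
  measurable_fun `]a, b] f ->
  (forall x, a < x <= b -> (0 <= f x)%E) ->
  (\int[mu]_(x in `]a, b]) f x < +oo)%E -> 0 < e ->
  exists2 s, a < s <= b & (\int[mu]_(x in `]a, s]) f x <= e%:E)%E.
Proof.
move=> ab mf f0 foo e0.
(* These right ends decrease from [b] to [a], so each point above [a] is eventually left out: the
   restrictions of [f] tend to 0 pointwise and are dominated by [f]. *)
pose s n : R := a + (b - a) / n.+1%:R.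
pose f_ (n : nat) := f \_ `]a, s n].
have sab n : a < s n <= b.
  rewrite /s ltrDl divr_gt0 ?subr_gt0//= -lerBrDl ler_pdivrMr// ler_peMr//.
    by rewrite subr_ge0 ltW.
  by rewrite ler1n.
have subs n : `]a, b]%classic `&` `]a, s n]%classic = `]a, s n]%classic.
  apply/seteqP; split=> [x [] //|x /=]; rewrite !in_itv/= => /andP[ax xs].
  by have /andP[_ sb] := sab n; rewrite ax xs (le_trans xs sb).
have [] := @dominated_integral_small `]a, b]%classic f_ f e.
- exact: measurable_itv.
- move=> n; apply/measurable_restrict; [exact: measurable_itv..|].
  by apply: measurable_funS mf => //; exact: subIsetl.
- exact: mf.
- move=> n x /=; rewrite in_itv/= => /f0 fx0; rewrite /f_ patchE.
  by case: ifPn.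
- move=> x /=; rewrite in_itv/= => /andP[ax xb] d d0.
  have xa : 0 < (x - a) / (b - a) by rewrite divr_gt0// subr_gt0.
  near=> n; rewrite /f_ patchE ifF ?lee_fin ?(ltW d0)//; apply/negP.
  rewrite inE/= in_itv/= => /andP[_]; rewrite leNgt => /negP; apply.
  rewrite /s -ltrBrDl mulrC -ltr_pdivlMr ?subr_gt0//.
  by near: n; exact: near_infty_natSinv_lt (PosNum xa).
- exact: foo.
- exact: e0.
move=> n; rewrite /f_ -integral_mkcondr subs => h.
by exists (s n).
Unshelve. all: by end_near. Qed.

End Integration.

(** * Level cuts *)

Section Cuts.
Context (R : realType) (m : nat).
Implicit Types (u v : 'rV[R]_m -> R) (A B : R -> set 'rV[R]_m) (x y : R).
Local Notation mu := (@lebesgue_measure R).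
Local Notation H := (@hausdorff_dist R m).

(** Continuity from the left for the Hausdorff distance. Nonemptiness is included because the
    triangle inequality asks for it. *)
Definition left_hcontinuous (a b : R) A :=
  forall x, a < x <= b -> A x !=set0 /\
    forall e, 0 < e -> exists2 y0, y0 < x &
      forall y, a < y -> y0 < y <= x -> (H (A y) (A x) <= e%:E)%E.

Lemma left_hcontinuous_le (a a' b : R) A : a <= a' ->
  left_hcontinuous a b A -> left_hcontinuous a' b A.
Proof.
move=> aa' hA x /andP[a'x xb].
have [|A0 hx] := hA x; first by rewrite (le_lt_trans aa').
split=> // e e0; have [y0 y0x h] := hx e e0.
by exists y0 => // y a'y; apply: h; exact: le_lt_trans a'y.
Qed.

Lemma left_hcontinuous_cst (a b : R) (C : set 'rV[R]_m) : C !=set0 ->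
  left_hcontinuous a b (fun=> C).
Proof.
move=> C0 x /andP[ax xb]; split=> // e e0; exists a => // y _ _.
by rewrite hausdorff_distxx// lee_fin ltW.
Qed.

(** A small move to the left changes each set by at most [e], so the distance drops by at most
    [e + e]: it is lower semicontinuous from the left. *)
Lemma measurable_hausdorff_dist (a b : R) A B :
  left_hcontinuous a b A -> left_hcontinuous a b B ->
  measurable_fun `]a, b] (fun x => H (A x) (B x)).
Proof.
move=> hA hB; apply: left_lsc_measurable => x c axb cx.
have [Ax0 hAx] := hA x axb; have [Bx0 hBx] := hB x axb.
have [e e0 ce] : exists2 e : R, 0 < e & ((c + (e + e))%:E < H (A x) (B x))%E.
  move: cx; have := hausdorff_dist_ge0 (B x) Ax0.
  case: (H (A x) (B x)) => [s| |] // _; rewrite ?lte_fin => cs.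
    by exists ((s - c) / 4); rewrite ?lte_fin; lra.
  by exists 1; rewrite ?ltr01// ltry.
have [y1 y1x hy1] := hAx e e0; have [y2 y2x hy2] := hBx e e0.
have [_ xb] := andP axb.
exists (Num.max y1 y2); first by rewrite gt_max y1x.
move=> y ay; rewrite gt_max => /andP[/andP[y1y y2y] yx].
have [|Ay0 _] := hA y; first by rewrite ay (le_trans yx).
have [|By0 _] := hB y; first by rewrite ay (le_trans yx).
have hAy := hy1 y ay; rewrite y1y yx in hAy.
have hBy := hy2 y ay; rewrite y2y yx in hBy.
have : (H (A x) (B x) <= e%:E + (H (A y) (B y) + e%:E))%E.
  apply: (le_trans (hausdorff_dist_triangle (B x) Ax0 Ay0)).
  rewrite leeD//; first by rewrite hausdorff_distC hAy.
  apply: (le_trans (hausdorff_dist_triangle (B x) Ay0 By0)).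
  by rewrite leeD// hBy.
move=> /(lt_le_trans ce); case: (H (A y) (B y)) => [s| |] //.
  by rewrite -!EFinD !lte_fin => h; lra.
by move=> _; rewrite ltry.
Qed.

Lemma alpha_cutE u x : 0 < x -> alpha_cut u x = [set y | x <= u y].
Proof. by move=> x0; rewrite /alpha_cut gt_eqF. Qed.

Lemma alpha_cut_le u x y : 0 < x -> x <= y -> alpha_cut u y `<=` alpha_cut u x.
Proof.
move=> x0 xy; rewrite !alpha_cutE//; last exact: lt_le_trans xy.
by move=> z /=; exact: le_trans.
Qed.

Lemma alpha_cut_indic0 x : 0 < x <= 1 ->
  alpha_cut (\1_[set (0 : 'rV[R]_m)]) x = [set 0].
Proof.
move=> /andP[x0 x1]; rewrite alpha_cutE//; apply/seteqP; split=> y /=.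
  rewrite indicE; case: (boolP (y \in [set 0])) => [/set_mem//|_] /=.
  by rewrite leNgt x0.
by move=> ->; rewrite indicE mem_set.
Qed.

Lemma closed_alpha_cut u x : upper_semicontinuous u -> 0 < x ->
  closed (alpha_cut u x).
Proof.
move=> uscu x0; rewrite alpha_cutE// -[X in closed X]setCK; apply: open_closedC.
rewrite openE => y /= /negP; rewrite -ltNge => /uscu.
by apply: filterS => z uz /=; apply/negP; rewrite -ltNge.
Qed.

Context (p : R) (hp : 1 <= p).
Let p0 : 0 < p. Proof. exact: lt_le_trans hp. Qed.

Lemma normal_alpha_cut_neq0 u x : (exists z, u z = 1) -> 0 < x -> x <= 1 ->
  alpha_cut u x !=set0.
Proof. by move=> [z uz1] x0 x1; exists z; rewrite alpha_cutE//= uz1. Qed.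

Lemma FB_alpha_cut_neq0 u x : FB p u -> 0 < x -> x <= 1 -> alpha_cut u x !=set0.
Proof. by move=> [_ nu _ _]; exact: normal_alpha_cut_neq0. Qed.

Lemma measurable_radius u : (exists z, u z = 1) ->
  measurable_fun `](0 : R), 1] (fun x : R => H (alpha_cut u x) [set 0]).
Proof.
move=> nu; apply: nonincreasing_emeasurable => x y x0 xy y1.
apply: hausdorff_dist0_sub; last exact: alpha_cut_le.
by apply: (normal_alpha_cut_neq0 nu) => //; exact: lt_le_trans xy.
Qed.

Lemma FB_integral_radius u : FB p u ->
  (\int[mu]_(x in `]0%R, 1%R]) (H (alpha_cut u x) [set 0%R] `^ p) < +oo)%E.
Proof.
move=> FBu; have [_ nu _] := FBu.
rewrite -integral_itv_obnd_cbnd//.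
  by move/lty_poweRy; apply; rewrite gt_eqF// invr_gt0.
by apply: measurable_fun_poweR; [|exact: measurable_radius].
Qed.

(** The radius is nonincreasing in the level, so on []0, x]] the integrand is at least its value at
    [x]. *)
Lemma radius_markov u x : FB p u -> 0 < x <= 1 ->
  (x%:E * H (alpha_cut u x) [set 0%R] `^ p <=
   \int[mu]_(y in `]0%R, 1%R]) (H (alpha_cut u y) [set 0%R] `^ p))%E.
Proof.
move=> FBu /andP[x0 x1]; have [_ nu _ _] := FBu.
have sub : [set` `]0, x]] `<=` [set` `](0 : R), 1]].
  by move=> y /=; rewrite !in_itv/= => /andP[-> /le_trans->].
have mP : measurable_fun `](0 : R), 1]
    (fun y : R => H (alpha_cut u y) [set 0%R] `^ p)%E.
  by apply: measurable_fun_poweR => //; exact: measurable_radius.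
apply: (@le_trans _ _
    (\int[mu]_(y in `]0%R, x]) (H (alpha_cut u y) [set 0%R] `^ p))%E); last first.
  apply: ge0_subset_integral => //.
  by move=> y _; exact: poweR_ge0.
have -> : (x%:E * H (alpha_cut u x) [set 0%R] `^ p =
    \int[mu]_(y in `]0%R, x]) (cst (H (alpha_cut u x) [set 0%R] `^ p)) y)%E.
  rewrite integral_cst//= lebesgue_measure_itv/= lte_fin x0.
  by rewrite -EFinB subr0 muleC.
apply: ge0_le_integral => //.
- by move=> y _; exact: poweR_ge0.
- exact: measurable_funS mP.
- move=> y /=; rewrite in_itv/= => /andP[y0 yx]; apply: poweR_le => //.
    by apply: hausdorff_dist_ge0; exact: (FB_alpha_cut_neq0 FBu).
  apply: hausdorff_dist0_sub; last exact: alpha_cut_le.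
  exact: (FB_alpha_cut_neq0 FBu).
Qed.

Lemma FB_radius_lty u x : FB p u -> 0 < x -> x <= 1 ->
  (H (alpha_cut u x) [set 0%R] < +oo)%E.
Proof.
move=> FBu x0 x1; apply: (@lty_poweRy _ _ p); first by rewrite gt_eqF.
have x01 : 0 < x <= 1 by rewrite x0.
have := le_lt_trans (radius_markov FBu x01) (FB_integral_radius FBu).
have := poweR_ge0 (H (alpha_cut u x) [set 0%R]) p.
case: (_ `^ _)%E => // [s _ _|_]; first by rewrite ltry.
by rewrite gt0_muley ?lte_fin// ltxx.
Qed.

Lemma compact_alpha_cut u x : FB p u -> 0 < x -> x <= 1 ->
  compact (alpha_cut u x).
Proof.
move=> FBu x0 x1; have [_ _ uscu _] := FBu.
apply: bounded_closed_compact; last exact: closed_alpha_cut.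
have := FB_radius_lty FBu x0 x1.
have := hausdorff_dist_ge0 [set 0] (FB_alpha_cut_neq0 FBu x0 x1).
case E : (H _ _) => [s| |] // s0 _; exists s; split; first exact: num_real.
move=> r sr y uy; have hr : (H (alpha_cut u x) [set 0%R] < r%:E)%E.
  by rewrite E lte_fin.
have [_ -> /ltW] := hausdorff_dist_lt hr uy.
by apply: le_trans; rewrite -[y in X in X <= _]subr0; exact: norm_le_eucl_dist.
Qed.

Lemma nbhs_eucl_dist (c : 'rV[R]_m) (e : R) : 0 < e ->
  \forall y \near c, eucl_dist y c < e.
Proof.
move=> e0; have d0 : 0 < e / m.+1%:R by rewrite divr_gt0// ltr0n.
apply/nbhs_ballP; exists (e / m.+1%:R) => // y; rewrite -ball_normE /= => cy.
apply: eucl_dist_lt_coord => // i; apply: le_trans (ltW cy).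
by apply: le_trans (coord_le_norm _ i); rewrite !mxE distrC.
Qed.

(* A cluster point of far-away points of the cuts of levels below [x] would lie
   in the cut of level [x], by semicontinuity. *)
Lemma FB_left_hcontinuous u : FB p u -> left_hcontinuous 0 1 (alpha_cut u).
Proof.
move=> FBu x /andP[x0 x1]; have [_ _ uscu _] := FBu.
have A0 := FB_alpha_cut_neq0 FBu x0 x1; split=> // e e0.
pose far (y : 'rV[R]_m) := forall b, alpha_cut u x b -> e < eucl_dist y b.
pose D := [set b : R | 0 < b < x].
pose bad (b : R) := [set y : 'rV[R]_m | b <= u y /\ far y].
have [[b [/andP[b0 bx] badb]]|allbad] :=
    pselect (exists b, D b /\ ~ (bad b !=set0)).
  (* A level [b] without far points is the required threshold: cuts of level in []b, x]] stay within
     [e] of the cut of level [x], which they contain. *)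
  exists b => // y y0 /andP[by_ yx]; apply: hausdorff_dist_le => [a ya|a xa].
    apply: contrapT => nb; apply: badb; exists a; split.
      by move: ya; rewrite alpha_cutE//=; exact: le_trans (ltW by_).
    by move=> c xc; rewrite ltNge; apply/negP => ac; apply: nb; exists c.
  by exists a; [exact: alpha_cut_le xa|rewrite eucl_distxx ltW].
exfalso.
(* Otherwise the sets [bad b] are nonempty and shrink as [b] grows, so they generate a proper
   filter; it clusters at some [c] because [bad (x / 2)] lies in a compact cut. *)
pose F := filter_from D bad.
have Dx2 : D (x / 2) by rewrite /D/=; lra.
have FF : ProperFilter F.
  apply: filter_from_proper; last first.
    by move=> b Db; apply: contrapT => nb; apply: allbad; exists b.
  apply: filter_from_filter; first by exists (x / 2).
  move=> b c /andP[b0 bx] /andP[c0 cx]; exists (Num.max b c).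
    by rewrite /D/= lt_max b0 gt_max bx.
  by move=> y [/=]; rewrite ge_max => /andP[by_ cy] fy.
have x2 : 0 < x / 2 by lra.
have [c [_ clc]] : alpha_cut u (x / 2) `&` cluster F !=set0.
  apply: (@compact_alpha_cut u (x / 2) FBu) => //; first by lra.
  by exists (x / 2) => // y [xy _]; rewrite alpha_cutE.
(* If [c] is in the cut of level [x], a far point within [e] of [c] is a contradiction. *)
have [xc|cx] := leP x (u c).
  have [y [[_ fy] yc]] := clc _ _ (ex_intro2 _ _ _ Dx2 (@subset_refl _ _))
    (nbhs_eucl_dist c e0).
  by have := lt_trans yc (fy c _); rewrite ltxx alpha_cutE// => /(_ xc).
(* A level strictly between [u c] and [x], kept positive by the maximum: near [c] the function is
   below [b], but on [bad b] it is at least [b]. *)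
pose b := Num.max (x / 2) ((u c + x) / 2).
have Db : D b by rewrite /D/= lt_max gt_max x2/=; lra.
have cb : u c < b by rewrite lt_max; apply/orP; right; lra.
have [y [[by_ _] yb]] := clc _ _ (ex_intro2 _ _ _ Db (@subset_refl _ _))
  (uscu _ _ cb).
by move: (le_lt_trans by_ yb); rewrite ltxx.
Qed.

Lemma FB_left_hcontinuous_shift u (a b h : R) : FB p u ->
  h <= a -> b <= 1 + h -> left_hcontinuous a b (fun x => alpha_cut u (x - h)).
Proof.
move=> FBu ha bh x /andP[hx x1].
have [|A0 hA] := @FB_left_hcontinuous u FBu (x - h); first by lra.
split=> // e e0; have [y0 y0x hy] := hA e e0.
exists (y0 + h); first by lra.
by move=> y hy' /andP[y0y yx]; apply: hy; lra.
Qed.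

End Cuts.

(** * The metric and the single-function case *)

(** Gives one index valid for all centres of a finite net, namely the maximum of the individual
    ones. *)
Lemma finite_set_bound (T : eqType) (F : set T) (P : T -> nat -> Prop) :
  finite_set F -> (forall x i j, (i <= j)%N -> P x i -> P x j) ->
  (forall x, F x -> exists n, P x n) -> exists n, forall x, F x -> P x n.
Proof.
move=> /finite_seqP[s ->] Pmon; elim: s => [_|x s IHs exP].
  by exists 0%N => x; rewrite /= in_nil.
have [y ys|n sn] := IHs; first by apply: exP => /=; rewrite inE orbC ys.
have [k xk] : exists k, P x k by apply: exP => /=; rewrite inE eqxx.
exists (maxn n k) => y /=; rewrite inE => /predU1P[->|ys].
  by apply: Pmon xk; exact: leq_maxr.
by apply: (Pmon _ n); [exact: leq_maxl|exact: sn].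
Qed.

Section PowerMean.
Context (R : realType) (m : nat).
Implicit Types (u v c : 'rV[R]_m -> R) (x y h e : R).
Local Notation mu := (@lebesgue_measure R).
Local Notation H := (@hausdorff_dist R m).
Context (p : R) (hp : 1 <= p).
Let p0 : 0 < p. Proof. exact: lt_le_trans hp. Qed.

Lemma FB_hausdorff_dist_ge0 u (A : set 'rV[R]_m) x : FB p u -> 0 < x <= 1 ->
  (0 <= H (alpha_cut u x) A)%E.
Proof.
move=> FBu /andP[x0 x1]; apply: hausdorff_dist_ge0.
exact: (FB_alpha_cut_neq0 FBu).
Qed.

Lemma measurable_FB_hausdorff_dist u v (a : R) : FB p u -> FB p v -> 0 <= a ->
  measurable_fun `]a, 1] (fun x => H (alpha_cut u x) (alpha_cut v x)).
Proof.
move=> FBu FBv a0; apply: measurable_hausdorff_dist.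
  exact: left_hcontinuous_le a0 (FB_left_hcontinuous hp FBu).
exact: left_hcontinuous_le a0 (FB_left_hcontinuous hp FBv).
Qed.

Lemma measurable_FB_shift u h : FB p u -> 0 <= h ->
  measurable_fun `]h, 1] (fun x => H (alpha_cut u x) (alpha_cut u (x - h))).
Proof.
move=> FBu h0; apply: measurable_hausdorff_dist.
  exact: left_hcontinuous_le h0 (FB_left_hcontinuous hp FBu).
by apply: (FB_left_hcontinuous_shift hp FBu); rewrite ?lexx// lerDl.
Qed.

(** The level 0, whose cut is a closure and may be unbounded, is a null set and is dropped. *)
Lemma dpE u v : FB p u -> FB p v -> dp p u v =
  ((\int[mu]_(x in `]0%R, 1%R]) (H (alpha_cut u x) (alpha_cut v x) `^ p)) `^ p^-1)%E.
Proof.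
move=> FBu FBv; rewrite /dp -integral_itv_obnd_cbnd//.
by apply: measurable_fun_poweR => //; exact: measurable_FB_hausdorff_dist.
Qed.

Lemma dp_indic0E u : FB p u -> dp p u (\1_[set 0]) =
  ((\int[mu]_(x in `]0%R, 1%R]) (H (alpha_cut u x) [set 0%R] `^ p)) `^ p^-1)%E.
Proof.
move=> FBu; have [_ nu _ _] := FBu; rewrite /dp.
have : forall x, 0 < x <= 1 -> alpha_cut (\1_[set (0 : 'rV[R]_m)]) x = [set 0].
  exact: alpha_cut_indic0.
move: (\1_[set 0]) => v cutv; rewrite -integral_itv_obnd_cbnd; last first.
  apply: (@eq_measurable_fun _ _ _ _ _
      (fun x : R => H (alpha_cut u x) [set 0%R] `^ p)%E).
    by move=> x; rewrite inE/= in_itv/= => x01; rewrite cutv.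
  by apply: measurable_fun_poweR => //; exact: measurable_radius.
apply: (congr1 (fun z : \bar R => z `^ p^-1)%E).
by apply: eq_integral => x; rewrite inE/= in_itv/= => x01; rewrite cutv.
Qed.

Lemma equi_integralE u h : FB p u -> 0 <= h ->
  (\int[mu]_(x in `[h, 1%R]) (H (alpha_cut u x) (alpha_cut u (x - h)%R) `^ p) =
   \int[mu]_(x in `]h, 1%R]) (H (alpha_cut u x) (alpha_cut u (x - h)%R) `^ p))%E.
Proof.
move=> FBu h0; rewrite integral_itv_obnd_cbnd//.
by apply: measurable_fun_poweR => //; exact: measurable_FB_shift.
Qed.

Lemma integral_FB_shift u v h : FB p u -> FB p v -> 0 <= h ->
  (\int[mu]_(x in `]h, 1%R])
     (H (alpha_cut u (x - h)%R) (alpha_cut v (x - h)%R) `^ p) <=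
   \int[mu]_(x in `]0%R, 1%R]) (H (alpha_cut u x) (alpha_cut v x) `^ p))%E.
Proof.
move=> FBu FBv h0.
have mP : measurable_fun `](0 : R), 1]
    (fun x => H (alpha_cut u x) (alpha_cut v x) `^ p)%E.
  by apply: measurable_fun_poweR => //; exact: measurable_FB_hausdorff_dist.
have sub : [set` `](0 : R), 1 - h]] `<=` [set` `](0 : R), 1]].
  by move=> x /=; rewrite !in_itv/= => /andP[-> /=]; lra.
have := @ge0_integral_shift R h 0 (1 - h)
  (fun x => H (alpha_cut u x) (alpha_cut v x) `^ p)%E.
rewrite add0r subrK => ->; last 2 first.
- exact: measurable_funS mP.
- by move=> x _; exact: poweR_ge0.
by apply: ge0_subset_integral => // x _; exact: poweR_ge0.
Qed.

Lemma hausdorff_alpha_cut_le u x y x' y' : 0 < y' -> y' <= y -> y <= x ->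
  x <= x' -> (H (alpha_cut u x) (alpha_cut u y) <=
              H (alpha_cut u x') (alpha_cut u y'))%E.
Proof.
move=> y0 yy yx xx; have y1 := lt_le_trans y0 yy.
have x1 := lt_le_trans y1 yx.
by apply: hausdorff_dist_subl; exact: alpha_cut_le.
Qed.

(* Near the level [0] the integrand is dominated by the radii of the cuts; away
   from it, the distance is monotone in [h] and dominated convergence applies. *)
Lemma FB_equi_left_continuous c e : FB p c -> 0 < e ->
  exists2 d, 0 < d & forall h, 0 <= h < d ->
    (\int[mu]_(x in `]h, 1%R])
       (H (alpha_cut c x) (alpha_cut c (x - h)%R) `^ p) <= e%:E)%E.
Proof.
move=> FBc e0; have [_ nc _ _] := FBc.
have K0 : 0 < 3 `^ p :> R by rewrite powR_gt0.
(* Two radius integrals over the low levels, each at most [e1], will cost [e / 2]; the high levels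
   get the other half. *)
pose e1 := e / (4 * 3 `^ p).
have e10 : 0 < e1 by rewrite divr_gt0// mulr_gt0.
have Ke1 : 3 `^ p * (e1 + e1) + e / 2 = e.
  by rewrite /e1; field; rewrite gt_eqF.
have mr : measurable_fun `](0 : R), 1] (fun x => H (alpha_cut c x) [set 0%R]).
  exact: measurable_radius.
have mrp : measurable_fun `](0 : R), 1]
    (fun x => H (alpha_cut c x) [set 0%R] `^ p)%E.
  exact: measurable_fun_poweR.
have [s /andP[s0 s1] hs] := ge0_integral_itv_small ltr01 mrp
  (fun x _ => poweR_ge0 _ p) (FB_integral_radius hp FBc) e10.
(* Shifts of at most [s / 2] keep [x - hn n] above [s / 2] for [x > s], so all integrands are
   dominated by the constant built from the cuts of levels 1 and [s / 2]. *)
pose hn (n : nat) : R := s / 2 / n.+1%:R.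
have hn0 n : 0 < hn n by rewrite !divr_gt0.
have hns n : hn n <= s / 2.
  by rewrite ler_pdivrMr// ler_peMr ?ler1n// divr_ge0// ltW.
have hnE n : hn n = s / 2 / n.+1%:R by [].
clearbody hn e1.
pose f_ (n : nat) (x : R) := (H (alpha_cut c x) (alpha_cut c (x - hn n)%R) `^ p)%E.
have s2 : 0 < s / 2 by rewrite divr_gt0.
have ltk : (H (alpha_cut c 1) (alpha_cut c (s / 2)%R) < +oo)%E.
  have c1 := FB_alpha_cut_neq0 FBc ltr01 (lexx 1).
  have o0 : [set (0 : 'rV[R]_m)] !=set0 by exists 0.
  apply: le_lt_trans (hausdorff_dist_triangle _ c1 o0) _.
  rewrite [X in (_ + X)%E]hausdorff_distC lte_add_pinfty// (FB_radius_lty hp)//.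
  lra.
have [n hn_small] : exists n, (\int[mu]_(x in `]s, 1%R]) f_ n x <= (e / 2)%:E)%E.
  apply: (@dominated_integral_small R `]s, 1]%classic f_
      (cst (H (alpha_cut c 1) (alpha_cut c (s / 2)%R) `^ p)%E)) => //.
  - move=> n; apply: measurable_fun_poweR => //.
    apply: (@measurable_funS _ _ _ _ `]hn n, 1]%classic) => //.
      move=> x /=; rewrite !in_itv/= => /andP[sx ->].
      by rewrite andbT (le_lt_trans (hns n))//; lra.
    by apply: measurable_FB_shift => //; exact: ltW.
  - move=> n x /=; rewrite in_itv/= => /andP[sx x1]; split; first exact: poweR_ge0.
    have hnn := hns n; have hn0n := hn0 n.
    apply: poweR_le => //; first by apply: FB_hausdorff_dist_ge0 => //; lra.
    by apply: hausdorff_alpha_cut_le; lra.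
  - move=> x /=; rewrite in_itv/= => /andP[sx x1] d d0.
    have x01 : 0 < x <= 1 by lra.
    have [cx hx] := FB_left_hcontinuous hp FBc x01.
    have [|y0 y0x hy] := hx (d `^ p^-1); first by rewrite powR_gt0.
    have dd : 0 < (x - y0) / (s / 2) by rewrite divr_gt0// subr_gt0.
    near=> n; rewrite /f_.
    have hnd : hn n < x - y0.
      rewrite hnE mulrC -ltr_pdivlMr//.
      by near: n; exact: near_infty_natSinv_lt (PosNum dd).
    have hnn := hns n; have hn0n := hn0 n.
    have -> : d%:E = ((d `^ p^-1)%:E `^ p)%E.
      by rewrite poweR_EFin -powRrM mulVf ?lt0r_neq0// powRr1// ltW.
    apply: poweR_le => //; first exact: FB_hausdorff_dist_ge0.
    rewrite hausdorff_distC; apply: hy; first by lra.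
    lra.
  - rewrite integral_cst//= lebesgue_measure_itv/= lte_fin; case: ifPn => _.
      rewrite -EFinB; apply: lte_mul_pinfty => //; first exact: poweR_ge0.
      by rewrite ge0_fin_numE ?poweR_ge0// poweR_lty.
      by rewrite ltry.
    by rewrite mule0 ltry.
  - by rewrite divr_gt0.
(* A single good shift suffices: above [s], the distance for a smaller [h] is at most the one for
   [hn n]. *)
exists (hn n) => // h /andP[h0 hhn]; have hnn := hns n.
rewrite (@ge0_integral_itv_split _ h s 1)//; first last.
- by move=> x _; exact: poweR_ge0.
- by apply: measurable_fun_poweR => //; exact: measurable_FB_shift.
- lra.
rewrite -Ke1 EFinD; apply: leeD.
(* Below [s] the two cuts are compared through the origin; translating by [h] moves the second
   radius integral into []0, s]] as well. *)
- have subs : [set` `]h, s]] `<=` [set` `](0 : R), 1]].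
    by move=> x /=; rewrite !in_itv/=; lra.
  have subs1 : [set` `]h, s]] `<=` [set` `]h, 1]].
    by move=> x /=; rewrite !in_itv/=; lra.
  apply: (@integral_poweR_le2 R p hp `]h, s]%classic _
    (fun x => H (alpha_cut c x) [set 0%R])
    (fun x => H (alpha_cut c (x - h)) [set 0%R])).
  + exact: measurable_itv.
  + by apply: (measurable_funS _ subs1) => //; exact: measurable_FB_shift.
  + exact: measurable_funS mr.
  + apply: measurable_hausdorff_dist.
      by apply: (FB_left_hcontinuous_shift hp FBc); lra.
    by apply: left_hcontinuous_cst; exists 0.
  + by move=> x /=; rewrite in_itv/= => hx; apply: FB_hausdorff_dist_ge0 => //; lra.
  + by move=> x /=; rewrite in_itv/= => hx; apply: FB_hausdorff_dist_ge0 => //; lra.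
  + by move=> x /=; rewrite in_itv/= => hx; apply: FB_hausdorff_dist_ge0 => //; lra.
  + move=> x /=; rewrite in_itv/= => hx.
    rewrite [X in (_ + X)%E]hausdorff_distC; apply: hausdorff_dist_triangle.
      by apply: (FB_alpha_cut_neq0 FBc); lra.
    by exists 0.
  + apply: le_trans hs; apply: ge0_subset_integral => //.
    * by apply: measurable_funS mrp => //= x /=; rewrite !in_itv/=; lra.
    * by move=> x _; exact: poweR_ge0.
    * by move=> x /=; rewrite !in_itv/=; lra.
  + have := @ge0_integral_shift R h 0 (s - h)
      (fun x => H (alpha_cut c x) [set 0%R] `^ p)%E.
    rewrite add0r subrK => ->; last 2 first.
    * by apply: measurable_funS mrp => //= x /=; rewrite !in_itv/=; lra.
    * by move=> x _; exact: poweR_ge0.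
    apply: le_trans hs; apply: ge0_subset_integral => //.
    * by apply: measurable_funS mrp => //= x /=; rewrite !in_itv/=; lra.
    * by move=> x _; exact: poweR_ge0.
    * by move=> x /=; rewrite !in_itv/=; lra.
- apply: le_trans hn_small; apply: integral_poweR_le => //.
  + apply: (@measurable_funS _ _ _ _ `]h, 1]%classic) => //.
      by move=> x /=; rewrite !in_itv/=; lra.
    exact: measurable_FB_shift.
  + apply: (@measurable_funS _ _ _ _ `]hn n, 1]%classic) => //.
      by move=> x /=; rewrite !in_itv/=; lra.
    by apply: measurable_FB_shift => //; lra.
  + by move=> x /=; rewrite in_itv/= => hx; apply: FB_hausdorff_dist_ge0 => //; lra.
  + move=> x /=; rewrite in_itv/= => hx.
    by apply: hausdorff_alpha_cut_le; lra.
Unshelve. all: by end_near. Qed.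

End PowerMean.

(** * Necessity *)

Section Necessity.
Context (R : realType) (m : nat).
Implicit Types (u v c : 'rV[R]_m -> R) (x y h e : R).
Local Notation mu := (@lebesgue_measure R).
Local Notation H := (@hausdorff_dist R m).
Context (p : R) (hp : 1 <= p).
Let p0 : 0 < p. Proof. exact: lt_le_trans hp. Qed.

Lemma powR_invK (r : R) : 0 <= r -> (r `^ p^-1) `^ p = r.
Proof. by move=> r0; rewrite -powRrM mulVf ?lt0r_neq0// powRr1. Qed.

Lemma dp_ltE u v e : FB p u -> FB p v -> 0 <= e ->
  (dp p u v < e%:E)%E =
  (\int[mu]_(x in `]0%R, 1%R]) (H (alpha_cut u x) (alpha_cut v x) `^ p) <
   (e `^ p)%:E)%E.
Proof.
move=> FBu FBv e0; rewrite (dpE hp FBu FBv) (poweR_inv_lt hp)//.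
exact: integral_poweR_ge0.
Qed.

Lemma dp_indic0_leE u e : FB p u -> 0 <= e ->
  (dp p u (\1_[set 0%R]) <= e%:E)%E =
  (\int[mu]_(x in `]0%R, 1%R]) (H (alpha_cut u x) [set 0%R] `^ p) <=
   (e `^ p)%:E)%E.
Proof.
move=> FBu e0; rewrite (dp_indic0E FBu) (poweR_inv_le hp)//.
exact: integral_poweR_ge0.
Qed.

Lemma equi_ltE u h e : FB p u -> 0 <= h -> 0 <= e ->
  ((\int[mu]_(x in `[h, 1%R])
      (H (alpha_cut u x) (alpha_cut u (x - h)%R) `^ p)) `^ p^-1 < e%:E)%E =
  (\int[mu]_(x in `]h, 1%R])
      (H (alpha_cut u x) (alpha_cut u (x - h)%R) `^ p) < (e `^ p)%:E)%E.
Proof.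
move=> FBu h0 e0; rewrite (equi_integralE hp FBu h0) (poweR_inv_lt hp)//.
exact: integral_poweR_ge0.
Qed.

Context (U : set ('rV[R]_m -> R)) (hU : U `<=` FB p).
Hypothesis tbU : totally_bounded (@FB R m p) (@dp R m p) U.

Lemma totally_bounded_mean_bounded : uniformly_p_mean_bounded p U.
Proof.
have [F [finF FFB cov]] := tbU ltr01.
have [n hn] : exists n : nat, forall c, F c ->
    (\int[mu]_(x in `]0%R, 1%R]) (H (alpha_cut c x) [set 0%R] `^ p) <= n%:R%:E)%E.
  apply: finite_set_bound => // [c i j ij /le_trans|c Fc].
    by apply; rewrite lee_fin ler_nat.
  have := FB_integral_radius hp (FFB _ Fc).
  have := integral_poweR_ge0 p `](0 : R), 1]%classic
    (fun x => H (alpha_cut c x) [set 0]).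
  case: (\int[_]_(_ in _) _)%E => [r| |] // r0 _.
  by exists (Num.bound r); rewrite lee_fin ltW// archi_boundP.
(* The 1 bounds the integral between [u] and its centre, and [n] the radius integrals of all
   centres. *)
have K0 : 0 < 3 `^ p * (1 + n%:R) by rewrite mulr_gt0 ?powR_gt0// ltr_wpDr.
exists ((3 `^ p * (1 + n%:R)) `^ p^-1); first by rewrite powR_gt0.
move=> u Uu; have FBu := hU Uu; have [_ nu _ _] := FBu.
rewrite dp_indic0_leE ?powR_ge0// powR_invK ?(ltW K0)//.
have [c Fc /=] := cov u Uu; have FBc := FFB _ Fc; have [_ nc _ _] := FBc.
rewrite dp_ltE// powR1 => /ltW dcu.
apply: (@integral_poweR_le2 R p hp `](0 : R), 1]%classic _
  (fun x => H (alpha_cut c x) (alpha_cut u x))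
  (fun x => H (alpha_cut c x) [set 0])).
- exact: measurable_itv.
- exact: measurable_radius.
- exact: (measurable_FB_hausdorff_dist hp).
- exact: measurable_radius.
- by move=> x /=; rewrite in_itv/=; exact: (@FB_hausdorff_dist_ge0 _ _ p).
- by move=> x /=; rewrite in_itv/=; exact: (@FB_hausdorff_dist_ge0 _ _ p).
- by move=> x /=; rewrite in_itv/=; exact: (@FB_hausdorff_dist_ge0 _ _ p).
- move=> x /=; rewrite in_itv/= => /andP[x0 x1].
  rewrite (hausdorff_distC (alpha_cut c x) (alpha_cut u x)).
  apply: hausdorff_dist_triangle; first exact: (FB_alpha_cut_neq0 FBu).
  exact: (FB_alpha_cut_neq0 FBc).
- exact: dcu.
- exact: hn.
Qed.

Lemma totally_bounded_equi_left_continuous : p_mean_equi_left_continuous p U.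
Proof.
move=> e e0; have K0 : 0 < 3 `^ p :> R by rewrite powR_gt0.
have ep0 : 0 < e `^ p by rewrite powR_gt0.
pose e1 := e `^ p / (4 * 3 `^ p).
have e10 : 0 < e1 by rewrite divr_gt0// mulr_gt0.
have [|F [finF FFB cov]] := tbU (_ : 0 < e1 `^ p^-1); first by rewrite powR_gt0.
have [n hn] : exists n : nat, forall c, F c ->
    forall h, 0 <= h < n.+1%:R^-1 -> (\int[mu]_(x in `]h, 1%R])
       (H (alpha_cut c x) (alpha_cut c (x - h)%R) `^ p) <= e1%:E)%E.
  apply: (@finite_set_bound _ _ (fun c n => forall h, 0 <= h < n.+1%:R^-1 ->
    (\int[mu]_(x in `]h, 1%R])
       (H (alpha_cut c x) (alpha_cut c (x - h)%R) `^ p) <= e1%:E)%E)) => //.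
    move=> c i j ij hi h /andP[h0 hj]; apply: hi; rewrite h0 (lt_le_trans hj)//.
    by rewrite lef_pV2 ?posrE ?ltr0n// ler_nat.
  move=> c Fc; have [d d0 hd] := FB_equi_left_continuous hp (FFB _ Fc) e10.
  have [n _ /(_ n (leqnn n)) /= nd] := near_infty_natSinv_lt (PosNum d0).
  by exists n => h /andP[h0 hn]; apply: hd; rewrite h0 (lt_trans hn).
exists n.+1%:R^-1 => // h u /andP[h0 hn1] Uu.
have FBu := hU Uu; have [c Fc /=] := cov u Uu; have FBc := FFB _ Fc.
rewrite (dp_ltE FBc FBu (powR_ge0 _ _)) (powR_invK (ltW e10)) => /ltW dcu.
rewrite equi_ltE// ?(ltW e0)//.
apply: (@le_lt_trans _ _ (3 `^ p * (e1 + e1 + e1))%:E); last first.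
  rewrite lte_fin (_ : _ * _ = 3 / 4 * e `^ p); last first.
    by rewrite /e1; field; rewrite gt_eqF.
  by rewrite gtr_pMl//; lra.
have sub : [set` `]h, 1]] `<=` [set` `](0 : R), 1]].
  by move=> x /=; rewrite !in_itv/= => /andP[hx ->]; rewrite (le_lt_trans h0 hx).
have subr : left_hcontinuous h 1 (fun x => alpha_cut u (x - h)) /\
    left_hcontinuous h 1 (fun x => alpha_cut c (x - h)).
  by split; apply: (FB_left_hcontinuous_shift hp _); rewrite ?lexx ?lerDl.
apply: (@integral_poweR_le3 R p hp `]h, 1]%classic _
  (fun x => H (alpha_cut c x) (alpha_cut u x))
  (fun x => H (alpha_cut c x) (alpha_cut c (x - h)))
  (fun x => H (alpha_cut c (x - h)) (alpha_cut u (x - h)))).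
- exact: measurable_itv.
- exact: (measurable_FB_shift hp).
- exact: (measurable_FB_hausdorff_dist hp).
- exact: (measurable_FB_shift hp).
- by case: subr => ? ?; exact: measurable_hausdorff_dist.
- by move=> x /= /sub; rewrite /= in_itv/=; exact: (@FB_hausdorff_dist_ge0 _ _ p).
- by move=> x /= /sub; rewrite /= in_itv/=; exact: (@FB_hausdorff_dist_ge0 _ _ p).
- by move=> x /= /sub; rewrite /= in_itv/=; exact: (@FB_hausdorff_dist_ge0 _ _ p).
- by move=> x /= xh; case: subr => _ hc; apply: hausdorff_dist_ge0; have [|] := hc x.
- move=> x /= xh; have /= := sub x xh; rewrite in_itv/= => /andP[x0 x1].
  have c0 := FB_alpha_cut_neq0 FBc x0 x1.
  have ch0 : alpha_cut c (x - h) !=set0 by case: subr => _ hc; have [|] := hc x.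
  rewrite (hausdorff_distC (alpha_cut c x) (alpha_cut u x)).
  apply: le_trans (hausdorff_dist_triangle _ (FB_alpha_cut_neq0 FBu x0 x1) ch0) _.
  rewrite leeD2r//; apply: hausdorff_dist_triangle => //.
  exact: (FB_alpha_cut_neq0 FBu).
- apply: le_trans dcu; apply: ge0_subset_integral.
  + exact: measurable_itv.
  + exact: measurable_itv.
  + by apply: measurable_fun_poweR => //; exact: (measurable_FB_hausdorff_dist hp).
  + by move=> x _; exact: poweR_ge0.
  + exact: sub.
- by apply: hn => //; rewrite h0.
- by apply: le_trans dcu; exact: (integral_FB_shift hp).
Qed.

End Necessity.

(** * Approximation by step functions *)

(** Compactness of a closed ball of the norm, covered by the interiors of Euclidean balls. *)
Lemma eucl_net (R : realType) (m : nat) (r e : R) : 0 < e ->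
  exists s : seq 'rV[R]_m,
    forall x : 'rV[R]_m, `|x| <= r -> exists2 y, y \in s & eucl_dist x y < e.
Proof.
move=> e0; pose K := [set x : 'rV[R]_m | `|x| <= r].
have cK : compact K.
  apply: bounded_closed_compact.
    exists r; split; first exact: num_real.
    by move=> t rt x /= /le_trans; apply; exact: ltW.
  apply: (@preimage_closed _ _ (fun x : 'rV[R]_m => `|x|) [set y | y <= r]).
    by move=> x _; exact: norm_continuous.
  exact: closed_le.
rewrite compact_cover in cK.
have [||D _ KD] := cK 'rV[R]_m setT (fun c => [set x | eucl_dist x c < e]^°).
- by move=> c _; exact: open_interior.
- by move=> x _; exists x => //; exact: nbhs_eucl_dist.
have /finite_seqP[s Ds] := finite_fset D.
exists s => x /KD; rewrite /cover Ds => -[c cs xc]; exists c => //.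
exact: interior_subset xc.
Qed.

Section StepFunctions.
Context (R : realType) (m : nat) (s : seq 'rV[R]_m) (n : nat).
Implicit Types (t : {ffun seq_sub s -> 'I_n.+2}).
Local Notation mu := (@lebesgue_measure R).
Local Notation H := (@hausdorff_dist R m).

(** Encoding the values as ranks in an ordinal makes the parameters [t] a finite type, whence a
    finite family of centres. *)
Definition step_fuzzy t (x : 'rV[R]_m) : R :=
  if insub x is Some g then (t g)%:R / n.+1%:R else 0.

Lemma step_fuzzy_itv t x : 0 <= step_fuzzy t x <= 1.
Proof.
rewrite /step_fuzzy; case: insub => [g|]; last by rewrite lexx ler01.
rewrite divr_ge0//= ler_pdivrMr ?ltr0n// mul1r ler_nat.
by rewrite -ltnS.
Qed.

Lemma step_fuzzy_gt0 t x : 0 < step_fuzzy t x -> x \in s.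
Proof.
rewrite /step_fuzzy; case: insubP => [g gs _ _|]; [exact: gs|by rewrite ltxx].
Qed.

Lemma step_fuzzy_in t (g : seq_sub s) :
  step_fuzzy t (ssval g) = (t g)%:R / n.+1%:R.
Proof. by rewrite /step_fuzzy (valK g). Qed.

(** Superlevel sets of positive level are finite, hence closed, and lie within the sum of the norms
    of the points of [s]. *)
Lemma step_fuzzy_FB (p : R) t : 1 <= p -> (exists x, step_fuzzy t x = 1) ->
  FB p (step_fuzzy t).
Proof.
move=> hp nt; have p0 : 0 < p by exact: lt_le_trans hp.
split => //; first exact: step_fuzzy_itv.
- move=> x a xa.
  have a0 : 0 < a by apply: le_lt_trans xa; have /andP[] := step_fuzzy_itv t x.
  have clC : closed [set y : 'rV[R]_m | a <= step_fuzzy t y].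
    have /accessible_finite_set_closed :=
      hausdorff_accessible (@norm_hausdorff R 'rV[R]_m).
    apply; apply: (@sub_finite_set _ _ [set` s]); last by apply/finite_seqP; exists s.
    by move=> y /= ay; apply: (@step_fuzzy_gt0 t); exact: lt_le_trans ay.
  have := closed_openC clC; rewrite openE => /(_ x).
  have : (~` [set y : 'rV[R]_m | a <= step_fuzzy t y]) x.
    by move=> /=; rewrite leNgt xa.
  move=> xC /(_ xC); rewrite /interior; apply: filterS => y /= /negP.
  by rewrite -ltNge.
- pose r : R := \sum_(g : seq_sub s) eucl_dist (ssval g) 0.
  have r0 : 0 <= r by apply: sumr_ge0 => g _; exact: eucl_dist_ge0.
  have hr x : 0 < x -> x <= 1 ->
      (H (alpha_cut (step_fuzzy t) x) [set 0%R] <= r%:E)%E.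
    move=> x0 x1.
    have near0 y : alpha_cut (step_fuzzy t) x y -> eucl_dist y 0 <= r.
      rewrite alpha_cutE//= => /(lt_le_trans x0)/step_fuzzy_gt0 ys.
      rewrite /r (bigD1 (SeqSub ys))//= lerDl.
      by apply: sumr_ge0 => g _; exact: eucl_dist_ge0.
    have [y xy] := normal_alpha_cut_neq0 nt x0 x1.
    apply: hausdorff_dist_le => [z xz|_ ->]; first by exists 0 => //; exact: near0.
    by exists y => //; exact: near0.
  apply: poweR_lty; rewrite -integral_itv_obnd_cbnd; last first.
    by apply: measurable_fun_poweR => //; exact: measurable_radius.
  apply: (@le_lt_trans _ _ (\int[mu]_(x in `]0%R, 1%R]) (cst r%:E x `^ p))%E).
    apply: (integral_poweR_le hp) => //.
    + exact: measurable_radius.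
    + move=> x /=; rewrite in_itv/= => /andP[x0 x1]; apply: hausdorff_dist_ge0.
      exact: normal_alpha_cut_neq0.
    + by move=> x /=; rewrite in_itv/= => /andP[x0 x1]; exact: hr.
  rewrite (eq_integral (cst (r%:E `^ p)%E))// integral_cst//=.
  by rewrite lebesgue_measure_itv/= lte_fin ltr01 -EFinB subr0 mule1 ltry.
Qed.

Lemma finite_step_fuzzy : finite_set [set v | exists t, v = step_fuzzy t].
Proof.
apply: (@sub_finite_set _ _ [set step_fuzzy t | t in [set: {ffun seq_sub s -> 'I_n.+2}]]).
  by move=> v [t ->]; exists t.
by apply: finite_image; exact: finite_finset.
Qed.

End StepFunctions.

Section Approximation.
Context (R : realType) (m : nat) (u : 'rV[R]_m -> R).
Context (s : seq 'rV[R]_m) (n : nat) (e : R).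
Local Notation H := (@hausdorff_dist R m).
Local Notation h := (n.+2%:R^-1 : R).
Hypothesis net : forall x, alpha_cut u h x -> exists2 g, g \in s & eucl_dist x g < e.

Let N0 : 0 < n.+2%:R :> R. Proof. by rewrite ltr0n. Qed.
Let h0 : 0 < h. Proof. by rewrite invr_gt0. Qed.

Definition near_level (k : nat) (g : seq_sub s) :=
  exists2 a, alpha_cut u (k%:R * h) a & eucl_dist (ssval g) a <= e.

Lemma near_level_le (k l : nat) g : (0 < k)%N -> (k <= l)%N ->
  near_level l g -> near_level k g.
Proof.
move=> k0 kl [a al ga]; exists a => //; apply: alpha_cut_le al.
  by rewrite mulr_gt0// ltr0n.
by rewrite ler_pM2r// ler_nat.
Qed.

(* The bottom step is raised to the level [1], since the cut of level [0] may
   be unbounded. *)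
Definition rank_level (g : seq_sub s) : 'I_n.+3 :=
  inord (\max_(j < n.+3 | (0 < j)%N && `[< near_level (maxn j.-1 1) g >]) j).

(** Nearness to the cut of a level passes to lower positive levels, so the ranks that pass the test
    form an initial segment, determined by its maximum. *)
Lemma leq_rank_level (j : nat) g : (0 < j)%N -> (j < n.+3)%N ->
  (j <= rank_level g)%N <-> near_level (maxn j.-1 1) g.
Proof.
move=> j0 jn; rewrite /rank_level inordK; last first.
  by rewrite ltnS; apply/bigmax_leqP => i _; rewrite -ltnS.
split=> [|nj]; last first.
  by apply: (@leq_bigmax_cond _ _ _ (Ordinal jn)); rewrite /= j0; exact/asboolP.
apply: contraPP => nj; apply/negP; rewrite -ltnNge -(prednK j0) ltnS.
apply/bigmax_leqP => i /andP[i0 /asboolP ni]; rewrite leqNgt; apply/negP => ji.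
by apply: nj; apply: near_level_le ni; lia.
Qed.

Definition step_approx := step_fuzzy (finfun rank_level : {ffun seq_sub s -> 'I_n.+3}).

Lemma hausdorff_step_approx (j : nat) (x : R) : (0 < j < n.+3)%N ->
  j.-1%:R * h < x <= j%:R * h ->
  (H (alpha_cut step_approx x) (alpha_cut u ((maxn j.-1 1)%:R * h)) <= e%:E)%E.
Proof.
move=> /andP[j0 jn] /andP[jx xj].
have x0 : 0 < x by apply: le_lt_trans jx; rewrite mulr_ge0// ltW.
(* For [x] in [](j - 1) h, j h]], a value [k h] reaches [x] exactly when [j <= k]. *)
have cutE (g : seq_sub s) : alpha_cut step_approx x (ssval g) <->
    near_level (maxn j.-1 1) g.
  rewrite -leq_rank_level// alpha_cutE//= /step_approx step_fuzzy_in ffunE.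
  split=> [xr|jr].
    suff : (j.-1 < rank_level g)%N by rewrite prednK.
    by rewrite -(ltr_nat R) -(ltr_pM2r h0) (lt_le_trans jx).
  by rewrite (le_trans xj)// ler_pM2r// ler_nat.
apply: hausdorff_dist_le => [y xy|a xa].
  have ys : y \in s.
    apply: (@step_fuzzy_gt0 R m s n.+1 (finfun rank_level)).
    by move: xy; rewrite alpha_cutE//=; exact: lt_le_trans.
  by have [/(_ xy)[a ? ?] _] := cutE (SeqSub ys); exists a.
have [|g gs ag] := net (x := a).
  apply: alpha_cut_le xa => //; rewrite -[leLHS]mul1r ler_pM2r// ler1n.
  by rewrite leq_max orbT.
exists g; last by rewrite eucl_distC ltW.
by apply/(cutE (SeqSub gs)); exists a => //; rewrite eucl_distC ltW.
Qed.

(** The index is the ceiling of [n.+2 * x], obtained by truncating [n.+2 * (1 - x)] since the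
    interval is closed on the right. *)
Lemma step_level (x : R) : 0 < x <= 1 ->
  exists2 j : nat, (0 < j < n.+3)%N & j.-1%:R * h < x <= j%:R * h.
Proof.
move=> /andP[x0 x1]; pose y := n.+2%:R * (1 - x).
have y0 : 0 <= y by rewrite mulr_ge0// subr_ge0.
have /andP[ky yk] := truncn_itv y0.
set k := Num.trunc y in ky yk.
have kn : (k < n.+2)%N.
  rewrite -(ltr_nat R) (le_lt_trans ky)// /y gtr_pMr//; lra.
exists (n.+2 - k)%N; first by lia.
have -> : (n.+2 - k).-1%:R = n.+2%:R - k.+1%:R :> R.
  by rewrite -natrB//; congr (_%:R); lia.
rewrite natrB 1?ltnW// ltr_pdivrMr// ler_pdivlMr//.
by move: ky yk; rewrite /y mulrBr mulr1 (mulrC x) => ky yk; lra.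
Qed.

Context (p : R) (FBu : FB p u).

Lemma step_approx_normal : exists x, step_approx x = 1.
Proof.
(* The top rank [n.+2] tests the level [n.+1 * h], so a net point close to that cut receives the
   value 1. *)
have [a ha] : alpha_cut u (n.+1%:R * h) !=set0.
  apply: (FB_alpha_cut_neq0 FBu); first by rewrite mulr_gt0// ltr0n.
  by rewrite ler_pdivrMr// mul1r ler_nat.
have [|g gs ag] := net (x := a).
  by apply: alpha_cut_le ha => //; rewrite -[leLHS]mul1r ler_pM2r// ler1n.
exists g; rewrite /step_approx (step_fuzzy_in _ (SeqSub gs)) ffunE.
suff -> : nat_of_ord (rank_level (SeqSub gs)) = n.+2 by rewrite divff// gt_eqF.
apply/eqP; rewrite eqn_leq -ltnS ltn_ord /=.
apply/leq_rank_level => //=; rewrite (maxn_idPl _)//.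
by exists a => //=; rewrite eucl_distC ltW.
Qed.

(** Here [j] is at least 2, so the cut being approximated has its level [(j - 1) h] between [x - h]
    and [x]. *)
Lemma step_approx_high (x : R) : h < x <= 1 ->
  (H (alpha_cut step_approx x) (alpha_cut u x) <=
   e%:E + H (alpha_cut u x) (alpha_cut u (x - h)))%E.
Proof.
move=> /andP[hx x1]; have x0 : 0 < x := lt_trans h0 hx.
have [|j /andP[j0 jn] jx] := @step_level x; first by rewrite x0.
have /andP[jx1 jx2] := jx.
have j1 : (1 < j)%N.
  rewrite ltnNge; apply/negP => jle; have je : j = 1%N by lia.
  by move: (lt_le_trans hx jx2); rewrite je mul1r ltxx.
have je : maxn j.-1 1 = j.-1 by apply/maxn_idPl; lia.
have jh : j%:R * h = j.-1%:R * h + h.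
  by rewrite -{1}(prednK j0) -natr1 mulrDl mul1r.
have := @hausdorff_step_approx j x _ jx; rewrite j0 jn je => /(_ isT) hj.
have jp0 : 0 < j.-1%:R * h by rewrite mulr_gt0// ltr0n; lia.
have c0 : alpha_cut u (j.-1%:R * h) !=set0.
  by apply: (FB_alpha_cut_neq0 FBu) => //; rewrite (le_trans (ltW jx1)).
have v0 := normal_alpha_cut_neq0 step_approx_normal x0 x1.
apply: le_trans (hausdorff_dist_triangle _ v0 c0) _; apply: leeD => //.
rewrite hausdorff_distC; apply: hausdorff_alpha_cut_le => //.
- by rewrite subr_gt0.
- by rewrite lerBlDr -jh.
- exact: ltW.
Qed.

(** On the bottom step the approximated cut has level [h]. It is compared with the cut of level [x]
    through the origin, and its radius is at most that of the larger cut. *)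
Lemma step_approx_low (x : R) : 0 < x <= h ->
  (H (alpha_cut step_approx x) (alpha_cut u x) <=
   e%:E + H (alpha_cut u x) [set 0%R] + H (alpha_cut u x) [set 0%R])%E.
Proof.
move=> /andP[x0 xh]; have h1 : h <= 1 by rewrite invf_le1// ler1n.
have x1 := le_trans xh h1.
have h1e : (H (alpha_cut step_approx x) (alpha_cut u h) <= e%:E)%E.
  have := @hausdorff_step_approx 1 x isT.
  by rewrite (_ : maxn 1.-1 1 = 1%N)// !mul1r mul0r x0 xh; apply.
have c0 := FB_alpha_cut_neq0 FBu h0 h1.
have v0 := normal_alpha_cut_neq0 step_approx_normal x0 x1.
apply: le_trans (hausdorff_dist_triangle _ v0 c0) _; rewrite -addeA.
apply: leeD => //.
apply: le_trans (hausdorff_dist_triangle _ c0 (ex_intro [set 0] 0 erefl)) _.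
rewrite (hausdorff_distC [set 0]); apply: leeD => //.
by apply: hausdorff_dist0_sub => //; exact: alpha_cut_le.
Qed.

End Approximation.

(** * Sufficiency *)

Section Sufficiency.
Context (R : realType) (m : nat).
Implicit Types (u v c : 'rV[R]_m -> R) (x y h e : R).
Local Notation mu := (@lebesgue_measure R).
Local Notation H := (@hausdorff_dist R m).
Context (p : R) (hp : 1 <= p).
Let p0 : 0 < p. Proof. exact: lt_le_trans hp. Qed.

(* The radius at a low level [x] is at most the radius at the level [x + s],
   controlled by [M], plus the distance between the two cuts. *)
Lemma integral_radius_low u (s h M e : R) : FB p u -> 0 < s -> 0 <= h -> h <= s ->
  h + s <= 1 ->
  (\int[mu]_(x in `]s, 1%R])
     (H (alpha_cut u x) (alpha_cut u (x - s)%R) `^ p) <= e%:E)%E ->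
  (\int[mu]_(x in `]0%R, 1%R]) (H (alpha_cut u x) [set 0%R] `^ p) <= M%:E)%E ->
  h * (M / s) <= e ->
  (\int[mu]_(x in `]0%R, h]) (H (alpha_cut u x) [set 0%R] `^ p) <=
   (3 `^ p * (e + e))%:E)%E.
Proof.
move=> FBu s0 h0 hs hs1 us uM hMe; have [_ nu _ _] := FBu.
have s1 : 0 < s <= 1 by lra.
have subh : [set` `]0, h]] `<=` [set` `](0 : R), 1]].
  by move=> x /=; rewrite !in_itv/=; lra.
have lc : left_hcontinuous 0 h (fun x => alpha_cut u (x + s)).
  have : left_hcontinuous 0 h (fun x => alpha_cut u (x - (- s))).
    by apply: (FB_left_hcontinuous_shift hp FBu); lra.
  by under eq_fun do rewrite opprK.
have lc0 : left_hcontinuous 0 h (alpha_cut u).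
  have : left_hcontinuous 0 h (fun x => alpha_cut u (x - 0)).
    by apply: (FB_left_hcontinuous_shift hp FBu); lra.
  by under eq_fun do rewrite subr0.
have mg : measurable_fun `]0, h] (fun x => H (alpha_cut u (x + s)) (alpha_cut u x)).
  exact: measurable_hausdorff_dist.
have mr : measurable_fun `]0, h] (fun x => H (alpha_cut u (x + s)) [set 0]).
  apply: measurable_hausdorff_dist => //.
  by apply: left_hcontinuous_cst; exists 0.
have ne x : 0 < x <= h -> alpha_cut u x !=set0 /\ alpha_cut u (x + s) !=set0.
  by move=> xh; split; apply: (FB_alpha_cut_neq0 FBu); lra.
apply: (@integral_poweR_le2 R p hp `]0, h]%classic _
  (fun x => H (alpha_cut u (x + s)) (alpha_cut u x))
  (fun x => H (alpha_cut u (x + s)) [set 0])).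
- exact: measurable_itv.
- exact: measurable_funS (measurable_radius nu).
- exact: mg.
- exact: mr.
- by move=> x /=; rewrite in_itv/= => /ne[? _]; exact: hausdorff_dist_ge0.
- by move=> x /=; rewrite in_itv/= => /ne[_ ?]; exact: hausdorff_dist_ge0.
- by move=> x /=; rewrite in_itv/= => /ne[_ ?]; exact: hausdorff_dist_ge0.
- move=> x /=; rewrite in_itv/= => /ne[? ?].
  rewrite (hausdorff_distC (alpha_cut u (x + s)) (alpha_cut u x)).
  exact: hausdorff_dist_triangle.
(* Translation by [s] carries []0, h]] into []s, 1]], where the hypothesis on the shift [s]
   applies. *)
- have := @ge0_integral_shift R s 0 h
    (fun x => H (alpha_cut u (x + s)) (alpha_cut u x) `^ p)%E.
  rewrite add0r => <-; last 2 first.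
  + exact: measurable_fun_poweR.
  + by move=> x _; exact: poweR_ge0.
  under eq_integral do rewrite subrK.
  apply: le_trans us; apply: ge0_subset_integral.
  + exact: measurable_itv.
  + exact: measurable_itv.
  + apply: measurable_fun_poweR => //.
    by apply: (measurable_FB_shift hp) => //; exact: ltW.
  + by move=> x _; exact: poweR_ge0.
  + by move=> x /=; rewrite !in_itv/=; lra.
(* The Markov bound at the level [s] also controls the radii at all levels [x + s]. *)
- have hbd : (H (alpha_cut u s) [set 0%R] `^ p <= (M / s)%:E)%E.
    have := le_trans (radius_markov hp FBu s1) uM.
    case: (_ `^ _)%E (poweR_ge0 (H (alpha_cut u s) [set 0%R]) p) => [r| |] //.
      by rewrite -EFinM !lee_fin ler_pdivlMr// mulrC.
    by rewrite gt0_muley ?lte_fin.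
  apply: (@le_trans _ _ (\int[mu]_(x in `]0%R, h]) (cst (M / s)%:E x))%E).
    apply: ge0_le_integral.
    + exact: measurable_itv.
    + by move=> x _; exact: poweR_ge0.
    + exact: measurable_fun_poweR.
    + exact: measurable_cst.
    + move=> x /=; rewrite in_itv/= => xh; apply: le_trans hbd.
      have [_ ?] := ne x xh.
      apply: (poweR_le hp); first exact: hausdorff_dist_ge0.
      by apply: hausdorff_dist0_sub => //; apply: alpha_cut_le; lra.
  rewrite integral_cst//= lebesgue_measure_itv/= lte_fin.
  case: ifPn => [_|]; first by rewrite -EFinB subr0 -EFinM lee_fin mulrC.
  have M0 : 0 <= M by rewrite -lee_fin (le_trans _ uM)//; exact: integral_poweR_ge0.
  by rewrite mule0 lee_fin => _; apply: le_trans hMe; rewrite mulr_ge0// divr_ge0// ltW.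
Qed.

Context (U : set ('rV[R]_m -> R)) (hU : U `<=` FB p).

Lemma mean_bounded_equi_totally_bounded :
  uniformly_p_mean_bounded p U -> p_mean_equi_left_continuous p U ->
  totally_bounded (@FB R m p) (@dp R m p) U.
Proof.
move=> [M' M'0 boundU] equiU eps eps0.
pose M := M' `^ p; have M0 : 0 < M by rewrite powR_gt0.
pose K : R := 3 `^ p.
have K1 : 1 <= K by rewrite -(powRr0 3) ler_powR// ?ler1n// ltW.
have K0 : 0 < K by lra.
pose E := eps `^ p; have E0 : 0 < E by rewrite powR_gt0.
(* With [d] below, the final estimate becomes [3 / 8 * E + E / 16 / K], less than [E]. The mesh
   [eta] of the net contributes at most [d] to each integral. *)
pose e1 := E / (16 * K ^+ 2).
have e10 : 0 < e1 by rewrite divr_gt0// mulr_gt0// exprn_gt0.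
pose d := E / (16 * K); have d0 : 0 < d by rewrite divr_gt0// mulr_gt0.
pose eta := d `^ p^-1; have eta0 : 0 < eta by rewrite powR_gt0.
have [|delta delta0 equi] := equiU (e1 `^ p^-1); first by rewrite powR_gt0.
have {}equi : forall h u, 0 <= h < delta -> U u -> (\int[mu]_(x in `]h, 1%R])
     (H (alpha_cut u x) (alpha_cut u (x - h)%R) `^ p) <= e1%:E)%E.
  move=> h u hd Uu; have := equi h u hd Uu; have /andP[h0 _] := hd.
  by rewrite (equi_ltE hp (hU Uu) h0) ?powR_ge0// (powR_invK hp) ?(ltW e10)// => /ltW.
have {}boundU : forall u, U u ->
    (\int[mu]_(x in `]0%R, 1%R]) (H (alpha_cut u x) [set 0%R] `^ p) <= M%:E)%E.
  by move=> u Uu; have := boundU u Uu; rewrite (dp_indic0_leE hp (hU Uu)) ?(ltW M'0).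
(* The bound [1 / 3] ensures [h + s <= 1] once [h < s]. *)
pose s := Num.min (delta / 2) (1 / 3).
have s0 : 0 < s by rewrite lt_min !divr_gt0.
have sd : s < delta by rewrite gt_min; apply/orP; left; lra.
have s13 : s <= 1 / 3 by rewrite ge_min lexx orbT.
(* A step [h] below [b] satisfies both [h < s] and [h * (M / s) <= e1], as the estimate of the low
   radii demands. *)
pose b := Num.min s (e1 * s / M).
have b0 : 0 < b by rewrite lt_min s0 divr_gt0// mulr_gt0.
have [k _ /(_ k (leqnn k)) /= kb] := near_infty_natSinv_lt (PosNum b0).
(* The index 0 would give a step of length 1, above [1 / 3]; so [k = n.+1]. *)
case: k kb => [|n] kb.
  by exfalso; move: kb; rewrite invr1 /b lt_min => /andP[+ _]; lra.
pose h : R := n.+2%:R^-1.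
have h0 : 0 < h by rewrite invr_gt0 ltr0n.
have hs : h < s by move: kb; rewrite lt_min => /andP[].
have hMe : h * (M / s) <= e1.
  move: kb; rewrite lt_min => /andP[_ /ltW hb].
  by rewrite mulrA ler_pdivrMr// -ler_pdivlMr.
have h1 : h <= 1 by lra.
pose rho := (M / h) `^ p^-1 + 1.
have [G netG] := @eucl_net R m rho eta eta0.
have net u : U u -> forall x : 'rV[R]_m, alpha_cut u h x ->
    exists2 g, g \in G & eucl_dist x g < eta.
  move=> Uu x ux; apply: netG.
  have hh : 0 < h <= 1 by rewrite h0.
  have := le_trans (radius_markov hp (hU Uu) hh) (boundU u Uu).
  have u0 := hausdorff_dist_ge0 [set 0] (FB_alpha_cut_neq0 (hU Uu) h0 h1).
  move=> rM; have : (H (alpha_cut u h) [set 0%R] < rho%:E)%E.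
    apply: (@le_lt_trans _ _ ((M / h) `^ p^-1)%:E); last by rewrite lte_fin ltrDl.
    have -> : H (alpha_cut u h) [set 0] = ((H (alpha_cut u h) [set 0%R] `^ p) `^ p^-1)%E.
      by rewrite -poweRrM mulfV ?lt0r_neq0// poweRe1.
    rewrite (poweR_inv_le hp) ?poweR_ge0 ?powR_ge0// (powR_invK hp); last first.
      by rewrite divr_ge0// ltW.
    move: rM; case: (_ `^ _)%E (poweR_ge0 (H (alpha_cut u h) [set 0%R]) p) => [r| |] //.
      by rewrite -EFinM !lee_fin ler_pdivlMr// mulrC.
    by rewrite gt0_muley ?lte_fin.
  move=> /hausdorff_dist_lt/(_ ux)[_ -> /ltW]; apply: le_trans.
  by rewrite -[x in X in X <= _]subr0; exact: norm_le_eucl_dist.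
(* Keeping only the normal step functions makes every centre an element of [FB p]. *)
exists [set v | (exists t, v = step_fuzzy (n := n.+1) (s := G) t) /\
    exists x : 'rV[R]_m, v x = 1].
split.
- by apply: sub_finite_set (finite_step_fuzzy G n.+1) => v [].
- by move=> v [[t ->] vn]; exact: step_fuzzy_FB.
move=> u Uu; have FBu := hU Uu; have [_ nu _ _] := FBu.
pose v := step_approx u G n eta.
have vn := step_approx_normal (net u Uu) FBu.
have FBv : FB p v by exact: step_fuzzy_FB.
exists v; first by split => //; eexists.
rewrite /= (dp_ltE hp FBv FBu) ?ltW// -/E.
have mH : measurable_fun `](0 : R), 1] (fun x => H (alpha_cut v x) (alpha_cut u x)).
  exact: (measurable_FB_hausdorff_dist hp).
have mu0 := measurable_radius nu.
have subl : [set` `]0, h]] `<=` [set` `](0 : R), 1]].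
  by move=> x /=; rewrite !in_itv/= => /andP[-> /=]; lra.
have subr : [set` `]h, 1]] `<=` [set` `](0 : R), 1]].
  by move=> x /=; rewrite !in_itv/= => /andP[+ ->]; lra.
have cst_eta (a c : R) : 0 <= a -> a <= c -> c <= 1 ->
    (\int[mu]_(x in `]a, c]) (cst eta%:E x `^ p) <= d%:E)%E.
  move=> a0 ac c1; rewrite (eq_integral (cst d%:E)); last first.
    by move=> x _; rewrite /cst poweR_EFin (powR_invK hp) ?ltW.
  rewrite integral_cst//= lebesgue_measure_itv/= lte_fin.
  case: ifPn => _; last by rewrite mule0 lee_fin ltW.
  by rewrite -EFinB -EFinM lee_fin ler_piMr ?(ltW d0)//; lra.
have low : (\int[mu]_(x in `]0%R, h]) (H (alpha_cut u x) [set 0%R] `^ p) <=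
    (K * (e1 + e1))%:E)%E.
  have hs1 : h + s <= 1 by lra.
  apply: (integral_radius_low FBu s0 (ltW h0) (ltW hs) hs1 _ (boundU u Uu) hMe).
  by apply: equi => //; rewrite ltW.
rewrite (ge0_integral_itv_split (ltW h0) h1); first last.
- by move=> x _; exact: poweR_ge0.
- exact: measurable_fun_poweR.
have EK : K * (d + K * (e1 + e1) + K * (e1 + e1)) + K * (d + e1) < E.
  have -> : K * (d + K * (e1 + e1) + K * (e1 + e1)) + K * (d + e1) =
      3 / 8 * E + E / 16 / K.
    by rewrite /d /e1; field; rewrite gt_eqF.
  have : E / 16 / K <= E / 16 by rewrite ler_pdivrMr// ler_peMr// divr_ge0// ltW.
  lra.
apply: (@le_lt_trans _ _ (K * (d + K * (e1 + e1) + K * (e1 + e1)) + K * (d + e1))%:E);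
  last by rewrite lte_fin.
rewrite EFinD; apply: leeD.
- apply: (@integral_poweR_le3 R p hp `]0, h]%classic _ (cst eta%:E)
    (fun x => H (alpha_cut u x) [set 0]) (fun x => H (alpha_cut u x) [set 0])).
  + exact: measurable_itv.
  + exact: measurable_funS mH.
  + exact: measurable_cst.
  + exact: measurable_funS mu0.
  + exact: measurable_funS mu0.
  + by move=> x /= /subl; rewrite /= in_itv/=; exact: (FB_hausdorff_dist_ge0 _ FBv).
  + by move=> x _; rewrite lee_fin ltW.
  + by move=> x /= /subl; rewrite /= in_itv/=; exact: (FB_hausdorff_dist_ge0 _ FBu).
  + by move=> x /= /subl; rewrite /= in_itv/=; exact: (FB_hausdorff_dist_ge0 _ FBu).
  + by move=> x /=; rewrite in_itv/=; exact: (step_approx_low (net u Uu) FBu).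
  + by apply: cst_eta => //; exact: ltW.
  + exact: low.
  + exact: low.
- have hd : 0 <= h < delta by rewrite ltW//= (lt_trans hs).
  have mh : measurable_fun `]h, 1] (fun x => H (alpha_cut u x) (alpha_cut u (x - h))).
    by apply: (measurable_FB_shift hp) => //; exact: ltW.
  apply: (@integral_poweR_le2 R p hp `]h, 1]%classic _ (cst eta%:E)
    (fun x => H (alpha_cut u x) (alpha_cut u (x - h)))).
  + exact: measurable_itv.
  + exact: measurable_funS mH.
  + exact: measurable_cst.
  + exact: mh.
  + by move=> x /= /subr; rewrite /= in_itv/=; exact: (FB_hausdorff_dist_ge0 _ FBv).
  + by move=> x _; rewrite lee_fin ltW.
  + by move=> x /= /subr; rewrite /= in_itv/=; exact: (FB_hausdorff_dist_ge0 _ FBu).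
  + by move=> x /=; rewrite in_itv/=; exact: (step_approx_high (net u Uu) FBu).
  + by apply: cst_eta => //; exact: ltW.
  + exact: equi.
Qed.

End Sufficiency.

Theorem theorem4p2 (R : realType) (m : nat) (p : R)
    (U : set ('rV[R]_m -> R)) (hm : (1 <= m)%N) (hp : 1 <= p)
    (hU : U `<=` FB p) :
  totally_bounded (@FB R m p) (@dp R m p) U <->
  uniformly_p_mean_bounded p U /\ p_mean_equi_left_continuous p U.
Proof.
split=> [tbU|[bU eU]].
  split; first exact: totally_bounded_mean_bounded.
  exact: totally_bounded_equi_left_continuous.
exact: mean_bounded_equi_totally_bounded.
Qed.
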